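(* Let $E$ be a locally complete locally convex Hausdorff space over $\mathbb{C}$, $V,U\subset\mathbb{C}^{d}$ open and $\gamma\colon[a,b]^{d}\to\mathbb{C}^{d}$ a $\mathcal{C}^{1}$-curve in $V$. a) Let $T$ be a set and $f,f_n\colon V\times T\to E$ such that $f(\cdot,t),f_n(\cdot,t)\colon V\to E$ are weakly $\gamma$-$\mathcal{C}^{1}$ for every $t\in T$, $n\in\mathbb{N}$, and $f_n\to f$ uniformly on $\gamma([a,b]^{d})\times T$. Then \[ \lim_{n\to\infty}\int_\gamma f_n(z,t)\,\mathrm{d}z=\int_\gamma f(z,t)\,\mathrm{d}z \] holds uniformly on $T$. b) Let $1\le j\le d$ and let $f\colon V\times U\to E$ be such that $f(\cdot,\lambda)\colon V\to E$ is weakly $\gamma$-$\mathcal{C}^{1}$ for every $\lambda\in U$, $f(z,\cdot)\colon U\to E$ is holomorphic for every $z\in V$, the derivative $(\partial_{\lambda_j})^{E}f\colon V\times U\to E$ exists with values in $E$ and is continuous, and $(\partial_{\lambda_j})^{E}f(\cdot,\lambda)\colon V\to E$ is weakly $\gamma$-$\mathcal{C}^{1}$ for every $\lambda\in U$. Then \[ G\colon U\to E,\quad G(\lambda):=\int_\gamma f(z,\lambda)\,\mathrm{d}z, \] is well-defined, complex differentiable with respect to $\lambda_j$ and \[ (\partial^{e_j}_{\mathbb{C}})^{E}G(\lambda)=\int_\gamma(\partial_{\lambda_j})^{E}f(z,\lambda)\,\mathrm{d}z\in E,\qquad\lambda\in U. \]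
   Context: $E$ is a non-trivial locally convex Hausdorff space with completion $\widehat{E}$ and dual $E'$. For a bounded, absolutely convex set (disk) $D\subset E$ put $E_D:=\bigcup_{n\in\mathbb{N}}nD$ normed by the gauge of $D$; $E$ is locally complete if $E_D$ is a Banach space for every closed disk $D$. A $\mathcal{C}^1$-curve in an open set $V\subset\mathbb{C}^d$ is a map $\gamma\colon[a,b]^d\to\mathbb{C}^d$, $\gamma(t)=(\gamma_1(t_1),\dots,\gamma_d(t_d))$, such that there are open sets $X_k\subset\mathbb{R}$ with $[a,b]\subset X_k$ and continuously differentiable extensions $\widetilde\gamma_k\colon X_k\to\mathbb{C}$ of $\gamma_k$ such that $\widetilde\gamma=(\widetilde\gamma_k)_k$ maps $X:=\prod_kX_k$ into $V$. A function $g\colon V\to E$ is weakly $\gamma$-$\mathcal{C}^1$ if there is such an extension $\widetilde\gamma$ for which $e'\circ g\circ\widetilde\gamma$ is continuously (real) partially differentiable on $X$ for every $e'\in E'$. $\int_\gamma g(z)\,\mathrm{d}z:=\int_{[a,b]^d}g(\gamma(t))\prod_{k=1}^d\gamma_k'(t_k)\,\mathrm{d}t$ as a Pettis-integral, i.e. the unique element $x\in E$ with $\langle e',x\rangle=\int_{[a,b]^d}\langle e',g(\gamma(t))\rangle\prod_k\gamma_k'(t_k)\,\mathrm{d}t$ for all $e'\in E'$ (integrands Lebesgue integrable). $f\colon\Omega\to E$, $\Omega\subset\mathbb{C}^d$ open, is holomorphic if for every $z\in\Omega$ there is a $\mathbb{C}$-linear map $df(z)\colon\mathbb{C}^d\to\widehat{E}$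 with $\lim_{w\to z,\,w\in\Omega,\,w\ne z}\frac{f(w)-f(z)-df(z)[w-z]}{|w-z|}=0$ in $\widehat{E}$, and $df(\cdot)[v]\colon\Omega\to\widehat{E}$ is continuous for every $v\in\mathbb{C}^d$. $(\partial^{e_j}_{\mathbb{C}})^{E}G(\lambda):=\lim_{h\to0,\,h\in\mathbb{C}\setminus\{0\}}\frac{G(\lambda+he_j)-G(\lambda)}{h}$ if the limit exists in $E$; $(\partial_{\lambda_j})^Ef(z,\lambda)$ is this derivative of $f(z,\cdot)$ at $\lambda$. ''Complex differentiable with respect to $\lambda_j$'' means this limit exists in $E$ at every $\lambda\in U$. Uniform convergence is with respect to every continuous seminorm of $E$. *)

(* Defs.v *)
From HB Require Import structures.
From mathcomp Require Import all_boot all_order all_algebra.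
From mathcomp Require Import all_classical all_reals all_analysis.
From mathcomp Require Import complex.

Set Implicit Arguments.
Unset Strict Implicit.
Unset Printing Implicit Defensive.

Import Order.TTheory GRing.Theory Num.Theory.
Import numFieldNormedType.Exports.

Local Open Scope classical_set_scope.
Local Open Scope complex_scope.
Local Open Scope ring_scope.

(* The topology exported by numFieldTopology is keyed on variables of a
   structure type, so the concrete field R[i] has to be equipped by hand. *)
#[non_forgetful_inheritance]
HB.instance Definition _ (R : realType) :=
  PseudoPointedMetric.copy R[i] R[i]^o.

Section lebesgue_cons.
Context {R : realType} (n : nat).
Variable m : {sigma_finite_measure set (n.-tuple R) -> \bar R}.

Definition cons_pair (p : measurableTypeR R * n.-tuple R) : n.+1.-tuple R :=
  [tuple of p.1 :: p.2].

Definition lebesgue_cons : set (n.+1.-tuple R) -> \bar R :=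
  pushforward (@lebesgue_measure R \x m)%E cons_pair.

Lemma measurable_cons_pair : measurable_fun setT cons_pair.
Proof. exact: measurable_cons. Qed.

HB.instance Definition _ := Measure.copy lebesgue_cons
  (measure_function_pushforward__canonical__measure_function_Measure
    (@lebesgue_measure R \x m)%E measurable_cons_pair).

Lemma sigma_finite_lebesgue_cons : sigma_finite setT lebesgue_cons.
Proof.
have /sigma_finiteP[F [TF ndF mF]] := sigma_finiteT (@lebesgue_measure R).
have /sigma_finiteP[G [TG ndG mG]] := sigma_finiteT m.
pose uncons (t : n.+1.-tuple R) : measurableTypeR R * n.-tuple R :=
  (tnth t ord0, [tuple of behead t]).
have muncons : measurable_fun setT uncons.
  apply/measurable_fun_pairP; split; first exact: measurable_tnth.
  exact: measurable_behead.
have consK : cancel cons_pair uncons.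
  by move=> [x t]; congr pair; exact/val_inj.
exists (fun i => uncons @^-1` (F i `*` G i)).
  apply/esym/seteqP; split => // t _.
  have [k _ Fk] : (\bigcup_i F i) (tnth t ord0) by rewrite -TF.
  have [l _ Gl] : (\bigcup_i G i) [tuple of behead t] by rewrite -TG.
  exists (maxn k l) => //; split => /=.
  - by move: Fk; exact/subsetPset/ndF/leq_maxl.
  - by move: Gl; exact/subsetPset/ndG/leq_maxr.
move=> i; have [mFi Fioo] := mF i; have [mGi Gioo] := mG i.
split.
  by rewrite -[X in measurable X]setTI; apply: muncons => //; exact: measurableX.
rewrite /lebesgue_cons /pushforward -comp_preimage.
rewrite (_ : uncons \o cons_pair = idfun) ?preimage_id; last exact/funext.
by rewrite product_measure1E// lte_mul_pinfty// ge0_fin_numE.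
Qed.

HB.instance Definition _ := Measure_isSigmaFinite.Build _ _ _ lebesgue_cons
  sigma_finite_lebesgue_cons.

End lebesgue_cons.

(* Lebesgue measure on the Borel sets of R^n, with R^n modelled as n.-tuple R:
   the n-fold product of lebesgue_measure *)
Fixpoint lebesgue_tuple (R : realType) (n : nat) :
    {sigma_finite_measure set (n.-tuple R) -> \bar R} :=
  match n with
  | 0 => \d_[tuple]
  | n'.+1 => lebesgue_cons (lebesgue_tuple R n')
  end.

Section locally_convex.
Context {R : realType}.
Implicit Types E F : tvsType R[i].

Definition absorbed E (D U : set E) :=
  exists2 r : R, 0 < r & forall x, D x -> exists2 y, U y & x = r%:C *: y.

Definition tvs_bounded E (D : set E) :=
  forall U : set E, nbhs 0 U -> absorbed D U.

Definition absolutely_convex E (D : set E) :=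
  convex_set (D : set (convex_lmodType E)) /\
  forall (c : R[i]) (x : E), `|c| <= 1 -> D x -> D (c *: x).

Definition disk E (D : set E) := tvs_bounded D /\ absolutely_convex D.

Definition disk_span E (D : set E) : set E :=
  [set x | exists n : nat, exists2 y, D y & x = n%:R *: y].

Definition gauge E (D : set E) (x : E) : R :=
  inf [set r : R | 0 < r /\ exists2 y, D y & x = r%:C *: y].

Definition disk_span_banach E (D : set E) :=
  forall u : nat -> E, (forall n, disk_span D (u n)) ->
    (forall e : R, 0 < e -> exists N : nat, forall m n : nat,
      (N <= m)%N -> (N <= n)%N -> gauge D (u m - u n) < e) ->
    exists2 x, disk_span D x & forall e : R, 0 < e -> exists N : nat,
      forall n : nat, (N <= n)%N -> gauge D (u n - x) < e.

Definition locally_complete E :=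
  forall D : set E, closed D -> disk D -> disk_span_banach D.

Definition seminorm E (p : E -> R) :=
  (forall x y, p (x + y) <= p x + p y) /\
  (forall (c : R[i]) x, p (c *: x) = complex.Re `|c| * p x).

Definition unif_cvg_seminorms E (X : Type) (A : set X)
    (u : nat -> X -> E) (v : X -> E) :=
  forall p : E -> R, seminorm p -> continuous p ->
  forall e : R, 0 < e -> exists N : nat, forall n : nat, (N <= n)%N ->
  forall x, A x -> p (u n x - v x) < e.

(* tvsType does not tie its uniform structure to the linear one, so the Cauchy
   condition is phrased with neighborhoods of 0 rather than with [cauchy]. *)
Definition tvs_complete F :=
  forall G : set_system F, ProperFilter G ->
    (forall U : set F, nbhs 0 U ->
      exists2 A, G A & forall x y, A x -> A y -> U (x - y)) ->
    exists l : F, G --> l.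

Definition is_completion E F (iota : {linear E -> F}) :=
  [/\ hausdorff_space F, tvs_complete F, continuous iota,
      forall U : set E, nbhs 0 U ->
        exists2 W : set F, nbhs 0 W & iota @^-1` W `<=` U
    & dense (range iota)].

End locally_convex.

Section complex_calculus.
Context {R : realType} (d : nat).
Implicit Types (E F : tvsType R[i]) (z w : 'rV[R[i]]_d).

Definition euclidean_norm (v : 'rV[R[i]]_d) : R[i] :=
  sqrtC (\sum_k `|v 0 k| ^+ 2).

Definition holomorphic E F (iota : {linear E -> F}) (Omega : set 'rV[R[i]]_d)
    (f : 'rV[R[i]]_d -> E) :=
  exists df : 'rV[R[i]]_d -> {linear 'rV[R[i]]_d -> F},
    (forall z, Omega z ->
      (fun w => (euclidean_norm (w - z))^-1 *:
        (iota (f w) - iota (f z) - df z (w - z))) @ within Omega z^' --> (0 : F))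
    /\ (forall v, {within Omega, continuous (fun z => df z v)}).

Definition is_cpartial E (j : 'I_d) (G : 'rV[R[i]]_d -> E) z (l : E) :=
  (fun h : R[i] => h^-1 *: (G (z + h *: delta_mx 0 j) - G z)) @ 0^' --> l.

Definition cpartial E (j : 'I_d) (G : 'rV[R[i]]_d -> E) z : E :=
  xget 0 (is_cpartial j G z).

End complex_calculus.

Section real_calculus.
Context {R : realType}.

(* derivative relative to D, hence one-sided at the endpoints of D = `[a, b] *)
Definition is_rderiv (D : set R) (phi : R -> R[i]) (t : R) (l : R[i]) :=
  (fun s : R => ((s - t)^-1)%:C * (phi s - phi t)) @ within D t^' --> l.

Definition rderiv (D : set R) (phi : R -> R[i]) (t : R) : R[i] :=
  xget 0 (is_rderiv D phi t).

Definition C1_on (X : set R) (phi : R -> R[i]) :=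
  exists2 psi : R -> R[i], forall t, X t -> is_rderiv X phi t (psi t) &
    {within X, continuous psi}.

Context (d : nat).

Definition is_rpartial (k : 'I_d) (phi : 'rV[R]_d -> R[i]) (x : 'rV[R]_d)
    (l : R[i]) :=
  (fun h : R => (h^-1)%:C * (phi (x + h *: delta_mx 0 k) - phi x)) @ 0^' --> l.

Definition C1_partial_on (X : set 'rV[R]_d) (phi : 'rV[R]_d -> R[i]) :=
  forall k, exists2 psi : 'rV[R]_d -> R[i],
    forall x, X x -> is_rpartial k phi x (psi x) &
    {within X, continuous psi}.

Definition curve (gamma : 'I_d -> R -> R[i]) (t : 'I_d -> R) : 'rV[R[i]]_d :=
  \row_k gamma k (t k).

Definition box (X : 'I_d -> set R) : set ('I_d -> R) :=
  [set t | forall k, X k (t k)].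

Definition cube (a b : R) : set ('I_d -> R) := box (fun=> `[a, b]%classic).

(* gamma k is only meaningful on `[a, b]; likewise, below, a function given on
   an open set is totalized, and only its values on that set are used *)
Definition C1_extension (V : set 'rV[R[i]]_d) (a b : R)
    (gamma : 'I_d -> R -> R[i]) (X : 'I_d -> set R) (gammat : 'I_d -> R -> R[i]) :=
  [/\ forall k, open (X k),
      forall k, `[a, b]%classic `<=` X k,
      forall k, C1_on (X k) (gammat k),
      forall k t, t \in `[a, b] -> gammat k t = gamma k t
    & curve gammat @` box X `<=` V].

Definition C1_curve (V : set 'rV[R[i]]_d) (a b : R) (gamma : 'I_d -> R -> R[i]) :=
  exists X gammat, C1_extension V a b gamma X gammat.

Definition weakly_C1 (E : tvsType R[i]) (V : set 'rV[R[i]]_d) (a b : R)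
    (gamma : 'I_d -> R -> R[i]) (g : 'rV[R[i]]_d -> E) :=
  exists X gammat, C1_extension V a b gamma X gammat /\
    forall e' : {scalar E}, continuous e' ->
      C1_partial_on [set x | box X (x 0)] (fun x => e' (g (curve gammat (x 0)))).

End real_calculus.

Section complex_integral.
Context {R : realType} (d : measure_display) (T : measurableType d).
Variables (mu : {measure set T -> \bar R}) (D : set T) (phi : T -> R[i]).

Definition cintegrable :=
  mu.-integrable D (EFin \o (fun t => complex.Re (phi t))) /\
  mu.-integrable D (EFin \o (fun t => complex.Im (phi t))).

Definition cintegral : R[i] :=
  Rintegral mu D (fun t => complex.Re (phi t)) +i*
  Rintegral mu D (fun t => complex.Im (phi t)).

End complex_integral.

Section curve_integral.
Context {R : realType} (E : tvsType R[i]) (d : nat).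
Variables (a b : R) (gamma : 'I_d -> R -> R[i]) (g : 'rV[R[i]]_d -> E).

Definition is_curve_integral (x : E) :=
  let Q := [set t : d.-tuple R | cube a b (tnth t)] in
  forall e' : {scalar E}, continuous e' ->
    let phi (t : d.-tuple R) := e' (g (curve gamma (tnth t))) *
      \prod_k rderiv `[a, b]%classic (gamma k) (tnth t k) in
    cintegrable (lebesgue_tuple R d) Q phi /\
    e' x = cintegral (lebesgue_tuple R d) Q phi.

Definition curve_integrable := exists! x, is_curve_integral x.

Definition curve_integral : E := xget 0 is_curve_integral.

End curve_integral.

(* Main.v *)
Require Import Defs.
From HB Require Import structures.
From mathcomp Require Import all_boot all_order all_algebra.
From mathcomp Require Import all_classical all_reals all_analysis.
From mathcomp Require Import complex measurable_realfun.
From mathcomp Require Import ring lra.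

Set Implicit Arguments.
Unset Strict Implicit.
Unset Printing Implicit Defensive.

Import Order.TTheory GRing.Theory Num.Theory.
Import numFieldNormedType.Exports.

Local Open Scope classical_set_scope.
Local Open Scope complex_scope.
Local Open Scope ring_scope.

(** The analytic input is the existence of the Pettis integral; once it is
    there, both parts follow from the estimate
      p (x) <= C * sup_{t in [a, b]^d} p (g (gamma t))
    for the integral x of g along gamma and a continuous seminorm p, where C
    depends only on gamma ([curve_integral_seminorm]).  That estimate is the
    Hahn-Banach theorem: some functional e' with |e'| <= p has Re (e' x) = p x,
    and e' x is an ordinary integral over the cube.

    Existence.  Let phi = g o gamma, with g weakly C^1.  For every e' in E' the
    function e' o phi is Lipschitz on the compact cube, by the mean value
    inequality applied to one coordinate at a time ([weakly_C1_lipschitz]).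
    Hence the values of phi together with its difference quotients form a weakly
    bounded set B.  Weakly bounded sets are bounded (Mackey,
    [weakly_bounded_bounded]), so the bipolar K of B is a closed disk, and local
    completeness makes E_K a Banach space.  Riemann sums of phi against the
    weight prod_k gamma_k'(t_k) over finer and finer grids are Cauchy in E_K:
    since K is cut out by functionals, this is tested on functionals, where it
    is the Lipschitz estimate for scalar integrals.  The limit in E_K is the
    integral ([weak_limit_exists], [weak_integral_exists]).  It is unique
    because E is Hausdorff, so that E' separates points.

    Part a) is the estimate applied to g = f_n(., t) - f(., t).  For part b), it
    is applied to g = h^-1 (f(., l + h e_j) - f(., l)) - d_j f(., l).  By the
    mean value inequality along the segment from l to l + h e_j, the value p (g)
    at z is at most twice the oscillation of d_j f(z, .) on that segment
    ([cpartial_mean_value]), and this oscillation is small uniformly in z on the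
    compact image of gamma because d_j f is jointly continuous
    ([near_compact_parameter]). *)

(** * The Hahn-Banach theorem *)

Section hahn_banach.
Context {R : realType} (V : lmodType R).
Implicit Types (p q : V -> R) (x y : V).

Definition sublinear q :=
  (forall x y, q (x + y) <= q x + q y) /\
  (forall r x, 0 <= r -> q (r *: x) = r * q x).

Lemma sublinearW q : (forall x y, q (x + y) <= q x + q y) ->
  (forall r x, 0 <= r -> q (r *: x) <= r * q x) -> sublinear q.
Proof.
move=> qD qZ; split=> // r x; rewrite le_eqVlt => /orP[/eqP<-|r0].
  apply/eqP; rewrite eq_le qZ//= mul0r scale0r.
  by have := qD 0 0; rewrite addr0; lra.
apply/eqP; rewrite eq_le qZ ?(ltW r0)//= mulrC -ler_pdivlMr// mulrC.
have := qZ r^-1 (r *: x); rewrite scalerK ?gt_eqF//; apply.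
by rewrite invr_ge0 ltW.
Qed.

Lemma sublinear0 q : sublinear q -> q 0 = 0.
Proof. by case=> _ /(_ 0 0 (lexx _)); rewrite scale0r mul0r. Qed.

Lemma sublinear_geN q x : sublinear q -> - q (- x) <= q x.
Proof.
by move=> qs; have := qs.1 x (- x); rewrite subrr sublinear0//; lra.
Qed.

(** The candidate is q'(x) = inf_{t >= 0} (q (x + t y) - t q y); the choice
    t = 0 gives q' <= q and t = 1 at x = - y gives the last bound.  It serves
    twice: it forces a minimal sublinear function to be odd, and it makes the
    functional found below attain p at a prescribed point. *)
Lemma sublinear_shift q y : sublinear q ->
  exists2 q', sublinear q' & (forall x, q' x <= q x) /\ q' (- y) <= - q y.
Proof.
move=> qs; have [qD qZ] := qs.
pose A x := [set q (x + t *: y) - t * q y | t in [set t : R | 0 <= t]].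
have Alb x : lbound (A x) (- q (- x)).
  move=> _ [t /= t0 <-]; have := qD (x + t *: y) (- x).
  by rewrite addrAC subrr add0r qZ//; lra.
have A0 x : A x !=set0 by exists (q (x + 0 *: y) - 0 * q y), 0 => /=.
have infA x t : 0 <= t -> inf (A x) <= q (x + t *: y) - t * q y.
  by move=> t0; apply: ge_inf; [exists (- q (- x))|exists t].
exists (fun x => inf (A x)); last first.
  split=> [x|]; first by have := infA x 0 (lexx _); rewrite scale0r addr0; lra.
  by have := infA (- y) 1 ler01; rewrite scale1r addNr sublinear0//; lra.
apply: sublinearW => [x1 x2|r x r0].
  rewrite -lerBlDr; apply: lb_le_inf => // _ [t /= t0 <-].
  rewrite lerBlDr -lerBlDl; apply: lb_le_inf => // _ [s /= s0 <-].
  rewrite lerBlDl; apply: le_trans (infA _ _ (addr_ge0 t0 s0)) _.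
  by have := qD (x1 + t *: y) (x2 + s *: y); rewrite addrACA -scalerDl; lra.
move: r0; rewrite le_eqVlt => /orP[/eqP<-|r0].
  by have := infA (0 *: x) 0 (lexx _); rewrite !scale0r addr0 sublinear0//; lra.
rewrite -ler_pdivrMl//; apply: lb_le_inf => // _ [t /= t0 <-].
rewrite ler_pdivrMl//.
apply: le_trans (infA _ _ (mulr_ge0 (ltW r0) t0)) _.
by rewrite -scalerA -scalerDr (qZ _ _ (ltW r0)) mulrBr mulrA.
Qed.

(** Zorn's lemma for the reverse pointwise order.  A chain has its pointwise
    infimum as a lower bound: it is finite because q x >= - p (- x) for every
    sublinear q <= p, and subadditive because any two members are comparable. *)
Lemma sublinear_minimal p : sublinear p ->
  exists q, [/\ sublinear q, (forall x, q x <= p x) &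
    forall q', sublinear q' -> (forall x, q' x <= q x) -> q' = q].
Proof.
move=> ps; pose T := {q : V -> R | sublinear q /\ forall x, q x <= p x}.
pose le (s t : T) : bool := `[< forall x, sval t x <= sval s x >].
suff [[q [qs qp]] qmin] : exists t, forall s, le t s -> s = t.
  exists q; split=> // q' q's q'q.
  have q'p x : q' x <= p x by exact: le_trans (q'q x) (qp x).
  by have /(_ (asboolT q'q)) [] := qmin (exist _ q' (conj q's q'p)).
apply: Zorn.
- by move=> t; apply/asboolP.
- move=> r s t /asboolP rs /asboolP st; apply/asboolP => x.
  exact: le_trans (st x) (rs x).
- move=> s t /asboolP st /asboolP ts; have : sval s = sval t.
    by apply/funext => x; apply/eqP; rewrite eq_le st ts.
  by case: s t {st ts} => [s ss] [t ts] /= st; exact: eq_exist.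
- move=> A Atot; have [[a0 Aa0]|A0] := pselect (A !=set0); last first.
    exists (exist _ p (conj ps (fun x => lexx _))) => s As.
    by case: A0; exists s.
  pose B x := [set sval s x | s in A].
  have Blb x : lbound (B x) (- p (- x)).
    move=> _ [[s [ss sp]] /= As <-]; have := sublinear_geN x ss.
    by have := sp (- x); lra.
  have B0 x : B x !=set0 by exists (sval a0 x), a0.
  have infB x s : A s -> inf (B x) <= sval s x.
    by move=> As; apply: ge_inf; [exists (- p (- x))|exists s].
  have ts : sublinear (fun x => inf (B x)).
    apply: sublinearW => [x1 x2|r x r0].
      rewrite -lerBlDr; apply: lb_le_inf => // _ [s As <-].
      rewrite lerBlDr -lerBlDl; apply: lb_le_inf => // _ [t At <-].
      rewrite lerBlDl; have [/asboolP st|/asboolP st] := Atot _ _ As At.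
        apply: le_trans (infB _ _ At) _; have := (svalP t).1.1 x1 x2.
        by have := st x1; lra.
      apply: le_trans (infB _ _ As) _; have := (svalP s).1.1 x1 x2.
      by have := st x2; lra.
    move: r0; rewrite le_eqVlt => /orP[/eqP<-|r0].
      have := infB (0 *: x) _ Aa0; rewrite scale0r sublinear0; first by lra.
      exact: (svalP a0).1.
    rewrite -ler_pdivrMl//; apply: lb_le_inf => // _ [s As <-].
    rewrite ler_pdivrMl//; have <- := (svalP s).1.2 _ x (ltW r0); exact: infB.
  have tp x : inf (B x) <= p x.
    by apply: le_trans (infB _ _ Aa0) _; exact: (svalP a0).2.
  exists (exist _ (fun x => inf (B x)) (conj ts tp) : T) => s As.
  by apply/asboolP => x /=; exact: infB.
Qed.

(** A minimal sublinear function is additive: [sublinear_shift] cannot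
    make it smaller, so it is odd, and an odd subadditive function is additive. *)
Lemma hahn_banach p x0 : sublinear p -> exists u : V -> R,
  [/\ forall x y, u (x + y) = u x + u y, forall r x, u (r *: x) = r * u x,
      forall x, u x <= p x & u x0 = p x0].
Proof.
move=> ps; have [p' p's [p'p p'x0]] := sublinear_shift x0 ps.
have [u [us up' umin]] := sublinear_minimal p's.
have uN x : u (- x) = - u x.
  have [q' q's [q'u q'x]] := sublinear_shift x us.
  have q'E := umin _ q's q'u; rewrite q'E in q'x.
  by apply/eqP; rewrite eq_le q'x /= lerNl -{2}(opprK x); rewrite -lerNl sublinear_geN.
have up x : u x <= p x by exact: le_trans (up' x) (p'p x).
exists u; split=> //.
- move=> x y; apply/eqP; rewrite eq_le us.1/=.
  by have := us.1 (- x) (- y); rewrite -opprD !uN; lra.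
- move=> r x; have [r0|r0] := leP 0 r; first exact: us.2.
  by rewrite -[r]opprK scaleNr uN us.2 ?mulNr// oppr_ge0 ltW.
- apply/eqP; rewrite eq_le up/=; have := up' (- x0); rewrite uN => h.
  by rewrite -lerN2; exact: le_trans h p'x0.
Qed.

End hahn_banach.

(** * Complex seminorms and functionals *)

Section complex_modulus.
Context {R : rcfType}.
Implicit Types z w c : R[i].
Import Normc.

Lemma normcE z : complex.Re `|z| = normc z. Proof. by []. Qed.

Lemma normc_ge0 z : 0 <= normc z.
Proof. by case: z => x y /=; exact: sqrtr_ge0. Qed.

Lemma normcR (r : R) : normc r%:C = `|r|.
Proof. by rewrite /= expr0n /= addr0 sqrtr_sqr. Qed.

Lemma normc_Re z : `|complex.Re z| <= normc z.
Proof. by rewrite -lecR; exact: normc_ge_Re. Qed.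

Lemma normc_Im z : `|complex.Im z| <= normc z.
Proof.
by case: z => x y /=; rewrite -sqrtr_sqr ler_wsqrtr// lerDr sqr_ge0.
Qed.

Lemma normc_ReIm z : normc z <= `|complex.Re z| + `|complex.Im z|.
Proof.
case: z => x y /=; rewrite -[leRHS]ger0_norm ?addr_ge0// -[leRHS]sqrtr_sqr.
rewrite ler_wsqrtr// sqrrD !real_normK ?num_real//.
by rewrite addrAC lerDl mulrn_wge0// mulr_ge0.
Qed.

(* [le_normcD] and [normcN] speak of the sum and the opposite of Rcomplex R;
   here they are those of R[i], which tactics do not identify. *)
Lemma normc_triangle z w : normc (z + w) <= normc z + normc w.
Proof. exact: le_normcD. Qed.

Lemma normc_opp z : normc (- z) = normc z.
Proof. exact: normcN. Qed.

Lemma normcB z w : normc (z - w) = normc (w - z).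
Proof. by rewrite -opprB normc_opp. Qed.

Lemma normc_dist z w : `|normc z - normc w| <= normc (z - w).
Proof.
have := normc_triangle (z - w) w; have := normc_triangle (w - z) z.
by rewrite !subrK [normc (w - z)]normcB ler_norml => ? ?; apply/andP; split; lra.
Qed.

Lemma normcV_real (r : R) : 0 < r -> normc (r^-1)%:C = r^-1.
Proof. by move=> r0; rewrite normcR ger0_norm// invr_ge0 ltW. Qed.

Lemma phase z : exists2 c, normc c = 1 & c * z = (normc z)%:C.
Proof.
have [->|z0] := eqVneq z 0.
  by exists 1; rewrite ?normc1// mulr0 normc0.
have nz0 : normc z != 0 by apply: contra z0 => /eqP/eq0_normc ->.
exists ((normc z)%:C / z); last by rewrite divfK.
by rewrite normcM normcV normcR ger0_norm ?normc_ge0// divff.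
Qed.

Lemma ReM_real (r : R) z : complex.Re (r%:C * z) = r * complex.Re z.
Proof. by case: z => x y; rewrite /= mul0r subr0. Qed.

Lemma ImM_real (r : R) z : complex.Im (r%:C * z) = r * complex.Im z.
Proof. by case: z => x y; rewrite /= mul0r addr0. Qed.

Lemma ReD z w : complex.Re (z + w) = complex.Re z + complex.Re w.
Proof. by case: z w => [? ?] [? ?]. Qed.

Lemma ImD z w : complex.Im (z + w) = complex.Im z + complex.Im w.
Proof. by case: z w => [? ?] [? ?]. Qed.

Lemma ReB z w : complex.Re (z - w) = complex.Re z - complex.Re w.
Proof. by case: z w => [? ?] [? ?]. Qed.

Lemma ImB z w : complex.Im (z - w) = complex.Im z - complex.Im w.
Proof. by case: z w => [? ?] [? ?]. Qed.

End complex_modulus.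

(** Restriction of scalars to R; the alias keeps the two module structures
    apart. *)
Definition realify (R : realType) (E : lmodType R[i]) : Type := E.

Section realify.
Context {R : realType} (E : lmodType R[i]).

HB.instance Definition _ := GRing.Zmodule.on (realify E).

Let rscale (r : R) (x : realify E) : realify E := (r%:C *: (x : E))%R.

Let rscaleA a b v : rscale a (rscale b v) = rscale (a * b) v.
Proof. by rewrite /rscale scalerA rmorphM. Qed.

Let rscale1 : left_id 1 rscale.
Proof. by move=> v; rewrite /rscale rmorph1 scale1r. Qed.

Let rscaleDr : right_distributive rscale +%R.
Proof. by move=> a u v; rewrite /rscale scalerDr. Qed.

Let rscaleDl v : {morph rscale^~ v : a b / a + b}.
Proof. by move=> a b; rewrite /rscale rmorphD scalerDl. Qed.

HB.instance Definition _ := GRing.Zmodule_isLmodule.Build R (realify E)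
  rscaleA rscale1 rscaleDr rscaleDl.

End realify.

Section seminorms.
Context {R : realType} {E : tvsType R[i]}.
Implicit Types (p : E -> R) (x y : E).
Import Normc.

Lemma seminormZ p c x : seminorm p -> p (c *: x) = normc c * p x.
Proof. by case=> _ ->. Qed.

Lemma seminormZr p (r : R) x : seminorm p -> 0 <= r -> p (r%:C *: x) = r * p x.
Proof. by move=> ps r0; rewrite seminormZ// normcR ger0_norm. Qed.

Lemma seminorm0 p : seminorm p -> p 0 = 0.
Proof. by move=> ps; rewrite -(scale0r 0) seminormZ// normc0 mul0r. Qed.

Lemma seminormN p x : seminorm p -> p (- x) = p x.
Proof. by move=> ps; rewrite -scaleN1r seminormZ// normc_opp normc1 mul1r. Qed.

Lemma seminorm_ge0 p x : seminorm p -> 0 <= p x.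
Proof.
move=> ps; have := ps.1 x (- x).
by rewrite subrr seminorm0// seminormN//; lra.
Qed.

Lemma seminorm_sublinear p : seminorm p -> sublinear (p : realify E -> R).
Proof. by move=> ps; split=> [|r x r0]; [exact: ps.1|exact: seminormZr]. Qed.

Lemma seminorm_dist p x y : seminorm p -> `|p x - p y| <= p (x - y).
Proof.
move=> ps; have := ps.1 (x - y) y; have := ps.1 (y - x) x.
rewrite !subrK -(seminormN (y - x))// opprB => h1 h2.
by rewrite ler_norml; apply/andP; split; lra.
Qed.

(** A complex functional is determined by its real part through
    e' x = u x - i u (i x).  Rotating x so that e' x becomes its own modulus
    turns the bound on u into the bound on e'. *)
Lemma complexify p (u : E -> R) : seminorm p ->
  (forall x y, u (x + y) = u x + u y) ->
  (forall (r : R) x, u (r%:C *: x) = r * u x) ->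
  (forall x, `|u x| <= p x) ->
  exists e' : {scalar E}, (forall x, complex.Re (e' x) = u x) /\
    forall x, normc (e' x) <= p x.
Proof.
move=> ps uD uZ up; pose f x := u x -i* u ('i *: x).
have fD x y : f (x + y) = f x + f y.
  by rewrite /f scalerDr !uD; apply/eqP; rewrite eq_complex /= opprD !eqxx.
have uN x : u (- x) = - u x.
  by have := uZ (-1) x; rewrite rmorphN1 scaleN1r mulN1r.
have fZ c x : f (c *: x) = c * f x.
  have fr (r : R) y : f (r%:C *: y) = r%:C * f y.
    rewrite /f scalerA mulrC -scalerA !uZ; apply/eqP.
    by rewrite eq_complex /=; apply/andP; split; apply/eqP; ring.
  have fi y : f ('i *: y) = 'i%C * f y.
    rewrite /f scalerA -expr2 sqr_i scaleN1r uN; apply/eqP.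
    by rewrite eq_complex /=; apply/andP; split; apply/eqP; ring.
  rewrite [in LHS](complexE c) scalerDl fD -scalerA fi !fr.
  by rewrite [in RHS](complexE c) mulrDl mulrA.
have flin : linear_for *%R f by move=> c x y; rewrite fD fZ.
pose e' : {scalar E} := HB.pack f (GRing.isLinear.Build _ _ _ _ f flin).
exists e'; split=> // x.
have [c c1 cx] := phase (f x).
have -> : normc (e' x) = u (c *: x).
  by have : complex.Re (f (c *: x)) = normc (f x) by rewrite fZ cx.
by apply: le_trans (ler_norm _) _; rewrite (le_trans (up _))// seminormZ// c1 mul1r.
Qed.

Lemma seminorm_attained p x0 : seminorm p -> exists e' : {scalar E},
  (forall x, normc (e' x) <= p x) /\ complex.Re (e' x0) = p x0.
Proof.
move=> ps.
have [u [uD uZ up ux0]] := hahn_banach (x0 : realify E) (seminorm_sublinear ps).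
have [|e' [e'u e'p]] := @complexify p u ps uD uZ.
  move=> x; rewrite ler_norml up andbT lerNl.
  have := uZ (-1) x; rewrite scaleN1r mulN1r => <-.
  by rewrite -(seminormN x)//; exact: up.
by exists e'; rewrite e'u.
Qed.

End seminorms.

(** * Seminorms and the topology of a locally convex space *)

Section complex_topology.
Context {R : realType}.
Implicit Types (z w : R[i]) (A : set R[i]).
Import Normc.

(** Real radii suffice, because a positive element of R[i] is a real number. *)
Lemma nbhs_complexP z A : nbhs z A <->
  exists2 e : R, 0 < e & forall w, normc (w - z) < e -> A w.
Proof.
split=> [/(@nbhs_ballP R[i] R[i]^o) [e e0 eA]|[e e0 eA]].
  have e_real : e = (complex.Re e)%:C by rewrite RRe_real// gtr0_real.
  exists (complex.Re e); first by rewrite -ltcR -e_real.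
  move=> w wz; apply: eA => /=; rewrite /ball /= /ball_ distrC.
  by rewrite e_real ltcR.
apply/(@nbhs_ballP R[i] R[i]^o); exists e%:C => /=; first by rewrite ltcR.
move=> w; rewrite /ball /= /ball_ distrC => wz; apply: eA.
by rewrite -ltcR.
Qed.

Lemma cvg_complexP (T : Type) (F : set_system T) (f : T -> R[i]) z : Filter F ->
  (f @ F --> z) <-> forall e : R, 0 < e -> \forall t \near F, normc (f t - z) < e.
Proof.
move=> FF; split=> [fz e e0|fz A /nbhs_complexP[e e0 eA]].
  by apply: (fz [set w | normc (w - z) < e]); apply/nbhs_complexP; exists e.
by apply: (@filterS _ F FF _ (f @^-1` A) _ (fz e e0)) => t; exact: eA.
Qed.

Lemma cvg_Re (T : Type) (F : set_system T) (f : T -> R[i]) z : Filter F ->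
  f @ F --> z -> (fun t => complex.Re (f t)) @ F --> complex.Re z.
Proof.
move=> FF /cvg_complexP fz; apply/cvgrPdist_lt => e e0.
apply: filterS (fz e e0) => t /=; rewrite normcB -ReB; apply: le_lt_trans.
exact: normc_Re.
Qed.

Lemma cvg_Im (T : Type) (F : set_system T) (f : T -> R[i]) z : Filter F ->
  f @ F --> z -> (fun t => complex.Im (f t)) @ F --> complex.Im z.
Proof.
move=> FF /cvg_complexP fz; apply/cvgrPdist_lt => e e0.
apply: filterS (fz e e0) => t /=; rewrite normcB -ImB; apply: le_lt_trans.
exact: normc_Im.
Qed.

End complex_topology.

Section seminorm_topology.
Context {R : realType} {E : tvsType R[i]}.
Implicit Types (p : E -> R) (x y : E) (A U : set E).
Import Normc.

Lemma seminorm_ball p x (e : R) : seminorm p -> continuous p -> 0 < e ->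
  nbhs x [set y | p (y - x) < e].
Proof.
move=> ps pc e0.
have /(nbhsT x) : nbhs (0 : E) [set y | p y < e].
  have := pc 0; rewrite /continuous_at seminorm0// => /cvgrPdist_lt/(_ e e0).
  apply: filterS => y /=; rewrite sub0r normrN; apply: le_lt_trans.
  exact: ler_norm.
by apply: filterS => _ [y /= py <-]; rewrite addrAC subrr add0r.
Qed.

Lemma seminorm_continuous p : seminorm p -> nbhs 0 [set x | p x <= 1] ->
  continuous p.
Proof.
move=> ps p1 x; apply/cvgrPdist_lt => e e0.
have e20 : 0 < e / 2 by rewrite divr_gt0.
have c0 : (e / 2)%:C != 0 :> R[i] by rewrite gt_eqF// ltcR.
apply: filterS (nbhsT x (nbhs0Z c0 p1)) => _ [_ [y /= py <-] <-] /=.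
apply: le_lt_trans (seminorm_dist _ _ ps) _.
rewrite -(seminormN _ ps) opprB [x + _]addrC addrK seminormZr ?ltW//.
apply: le_lt_trans (_ : e / 2 < e); last lra.
by rewrite ler_piMr// ltW.
Qed.

Lemma scalar_continuous p (e' : {scalar E}) : seminorm p -> continuous p ->
  (forall x, normc (e' x) <= p x) -> continuous e'.
Proof.
move=> ps pc e'p x; apply/cvg_complexP => e e0.
apply: filterS (seminorm_ball x ps pc e0) => y /=; apply: le_lt_trans.
by rewrite -linearB.
Qed.

Lemma scalar_seminorm (e' : {scalar E}) : continuous e' ->
  seminorm (fun x => normc (e' x)) /\ continuous (fun x => normc (e' x) : R).
Proof.
move=> e'c; have ps : seminorm (fun x => normc (e' x)).
  by split=> [x y|c x] /=; rewrite ?linearD ?normc_triangle// linearZ normcM.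
split=> //; apply: seminorm_continuous => //.
have := e'c 0; rewrite /continuous_at linear0 => /cvg_complexP/(_ 1 ltr01).
by apply: filterS => x /=; rewrite subr0 => /ltW.
Qed.

Lemma seminormM (r : R) p : 0 <= r -> seminorm p -> continuous p ->
  seminorm (fun x => r * p x) /\ continuous (fun x => r * p x : R).
Proof.
move=> r0 ps pc; split.
  split=> [x y|c x]; first by rewrite -mulrDr ler_wpM2l// ps.1.
  by rewrite ps.2 mulrCA.
by move=> x; apply: cvgMr; exact: pc.
Qed.

Lemma absolutely_convexD A x y (r s : R) : absolutely_convex A ->
  0 <= r -> 0 <= s -> A x -> A y ->
  exists2 z, A z & r%:C *: x + s%:C *: y = (r + s)%:C *: z.
Proof.
move=> [Acvx Abal] r0 s0 Ax Ay.
have [rs0|rs0] := eqVneq (r + s) 0.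
  have -> : r = 0 by lra.
  have -> : s = 0 by lra.
  by exists x => //; rewrite addr0 !scale0r addr0.
have rs1 : 0 < r + s by rewrite lt_neqAle eq_sym rs0 addr_ge0.
pose l := r / (r + s).
have l0 : 0 <= l%:C :> R[i] by rewrite lecR divr_ge0// ltW.
have l1 : l%:C <= 1 :> R[i] by rewrite (lecR l 1) ler_pdivrMr// mul1r; lra.
exists (l%:C *: x + (1 - l%:C) *: y).
  have := @Acvx x y (Itv01 l0 l1) (mem_set Ax) (mem_set Ay).
  by rewrite inE.
rewrite scalerDr !scalerA -(rmorph1 (real_complex R)) -rmorphB -!rmorphM/=.
rewrite mulrBr mulr1 /l [r / _]mulrC mulVKf//.
by rewrite [r + s - r]addrAC subrr add0r.
Qed.

Lemma gauge_lbound A x :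
  has_lbound [set r : R | 0 < r /\ exists2 y, A y & x = r%:C *: y].
Proof. by exists 0 => r [/ltW]. Qed.

Lemma gauge_le A x y (r : R) : 0 < r -> A y -> x = r%:C *: y -> gauge A x <= r.
Proof.
by move=> r0 Ay xy; apply: ge_inf; [exact: gauge_lbound|split=> //; exists y].
Qed.

Lemma gauge_lt A x (r s : R) : 0 < s ->
  (exists2 y, A y & x = s%:C *: y) -> gauge A x < r ->
  exists t y, [/\ 0 < t, t < r, A y & x = t%:C *: y].
Proof.
move=> s0 xs xr; have [|t [t0 [y Ay xy]] tr] := inf_lt _ xr.
  by exists s.
by exists t, y.
Qed.

(** Small multiples of x enter A, by continuity of c |-> c x at 0. *)
Lemma nbhs0_absorb A x : nbhs 0 A ->
  exists2 r : R, 0 < r & exists2 y, A y & x = r%:C *: y.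
Proof.
move=> A0; have := @scale_continuous R[i] E (0, x) A.
rewrite /= scale0r => /(_ A0) [[B1 B2] /= [B10 B2x] B12].
have [e e0 eB] := (nbhs_complexP _ _).1 B10.
have e20 : 0 < e / 2 by rewrite divr_gt0.
have c0 : (e / 2)%:C != 0 :> R[i] by rewrite gt_eqF// ltcR.
exists (e / 2)^-1; first by rewrite invr_gt0.
exists ((e / 2)%:C *: x).
  apply: (B12 ((e / 2)%:C, x)); split; last exact: nbhs_singleton.
  by apply: eB; rewrite subr0 normcR ger0_norm ?ltW//; lra.
by rewrite scalerA -rmorphM mulVf ?gt_eqF// scale1r.
Qed.

Lemma gauge_seminorm A : absolutely_convex A -> nbhs 0 A ->
  [/\ seminorm (gauge A), continuous (gauge A) &
      forall x, gauge A x < 1 -> A x].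
Proof.
move=> Aac A0; have [Acvx Abal] := Aac.
have abs x := nbhs0_absorb x A0.
have gD x y : gauge A (x + y) <= gauge A x + gauge A y.
  rewrite -lerBlDr; apply: lb_le_inf.
    by have [r r0 [z Az xz]] := abs x; exists r; split=> //; exists z.
  move=> r [r0 [x' Ax' ->]]; rewrite lerBlDr -lerBlDl; apply: lb_le_inf.
    by have [s s0 [z Az xz]] := abs y; exists s; split=> //; exists z.
  move=> s [s0 [y' Ay' ->]]; rewrite lerBlDl.
  have [z Az ->] := absolutely_convexD Aac (ltW r0) (ltW s0) Ax' Ay'.
  by apply: gauge_le Az _; rewrite // addr_gt0.
have gZle c x : c != 0 -> gauge A (c *: x) <= normc c * gauge A x.
  move=> c0; have nc0 : 0 < normc c.
    by rewrite lt_neqAle normc_ge0 eq_sym andbT; apply: contra c0 => /eqP/eq0_normc->.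
  rewrite -ler_pdivrMl//; apply: lb_le_inf.
    by have [r r0 [z Az xz]] := abs x; exists r; split=> //; exists z.
  move=> r [r0 [y Ay ->]]; rewrite ler_pdivrMl//.
  apply: (@gauge_le _ _ ((c / (normc c)%:C) *: y)); first by rewrite mulr_gt0.
    apply: Abal => //; rewrite -[X in _ <= X](rmorph1 (real_complex R)).
    by rewrite lecR normcM normcV normcR ger0_norm ?normc_ge0// divff ?gt_eqF.
  have nC0 : (normc c)%:C != 0 by rewrite gt_eqF// ltcR.
  by rewrite !scalerA rmorphM/=; congr (_ *: _); field.
have g0 : gauge A 0 <= 0.
  rewrite leNgt; apply/negP => h.
  have h2 : 0 < gauge A 0 / 2 by rewrite divr_gt0.
  have := @gauge_le A 0 0 _ h2 (nbhs_singleton A0); rewrite scaler0.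
  by move=> /(_ erefl); lra.
have ge0 x : 0 <= gauge A x.
  apply: lb_le_inf.
    by have [r r0 [z Az xz]] := abs x; exists r; split=> //; exists z.
  by move=> r [/ltW].
have gs : seminorm (gauge A).
  split=> // c x; rewrite normcE.
  have [->|c0] := eqVneq c 0.
    by rewrite scale0r normc0 mul0r; apply/eqP; rewrite eq_le g0 ge0.
  apply/eqP; rewrite eq_le gZle//=.
  have nc0 : 0 < normc c.
    by rewrite lt_neqAle normc_ge0 eq_sym andbT; apply: contra c0 => /eqP/eq0_normc->.
  rewrite -ler_pdivlMl//.
  have := @gZle c^-1 (c *: x); rewrite invr_eq0 scalerK// normcV; exact.
split=> //.
  apply: seminorm_continuous => //; apply: filterS A0 => x Ax /=.
  by apply: gauge_le Ax _; rewrite // scale1r.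
move=> x; have [s s0 xs] := abs x => /(gauge_lt s0 xs) [t [y [t0 t1 Ay ->]]].
apply: Abal => //; rewrite -[X in _ <= X](rmorph1 (real_complex R)).
by rewrite lecR normcR ger0_norm ltW.
Qed.

(** The gauge of a balanced convex neighborhood A contained in U.  A convex
    neighborhood W is made balanced by keeping the x with c x in W for all
    |c| <= 1; joint continuity of scaling at (0, 0) keeps it a neighborhood. *)
Lemma nbhs0_seminorm U : nbhs 0 U ->
  exists p, [/\ seminorm p, continuous p & forall x, p x < 1 -> U x].
Proof.
move=> U0; have [B Bcvx [Bo Bb]] := @locally_convex R[i] E.
have [W [BW W0] WU] := Bb 0 U U0.
have W0' : nbhs 0 W by apply: open_nbhs_nbhs; split=> //; exact: Bo.
pose A := [set x : E | forall c : R[i], `|c| <= 1 -> W (c *: x)].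
have AW : A `<=` W by move=> x /(_ 1); rewrite scale1r normr1; exact.
have Aac : absolutely_convex A.
  split=> [x y l /set_mem Ax /set_mem Ay|c x c1 Ax k k1].
    apply/mem_set => c c1.
    have := Bcvx W (mem_set BW) _ _ l (mem_set (Ax c c1)) (mem_set (Ay c c1)).
    by rewrite inE /conv/= !scalerDr !scalerA ![_ * c]mulrC -!scalerA.
  by rewrite scalerA; apply: Ax; rewrite normrM mulr_ile1.
have A0 : nbhs 0 A.
  have := @scale_continuous R[i] E (0, 0) W.
  rewrite /= scale0r => /(_ W0') [[B1 B2] /= [B10 B20] B12].
  have [e e0 eB] := (nbhs_complexP _ _).1 B10.
  have e20 : 0 < e / 2 by rewrite divr_gt0.
  have c0 : (e / 2)%:C != 0 :> R[i] by rewrite gt_eqF// ltcR.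
  apply: filterS (nbhs0Z c0 B20) => _ [y /= By <-] c c1; rewrite scalerA.
  apply: (B12 (c * (e / 2)%:C, y)); split=> //; apply: eB.
  rewrite subr0 normcM normcR ger0_norm ?ltW//.
  have {}c1 : normc c <= 1 by rewrite -lecR.
  apply: le_lt_trans (_ : e / 2 < e); last lra.
  by rewrite ler_piMl// ltW.
have [ps pc pA] := gauge_seminorm Aac A0.
by exists (gauge A); split=> // x /pA /AW /WU.
Qed.

Lemma nbhs_seminorm x A : nbhs x A ->
  exists p, [/\ seminorm p, continuous p & forall y, p (y - x) < 1 -> A y].
Proof.
move=> /(nbhsB (- x)); rewrite addNr => /nbhs0_seminorm[p [ps pc pA]].
exists p; split=> // y /pA [z Az]; rewrite addrC => /addIr <-; exact: Az.
Qed.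

(** A functional attaining a seminorm at y - x shows that every continuous
    seminorm vanishes there, so x and y have no disjoint neighborhoods. *)
Lemma scalar_separates x y : hausdorff_space E ->
  (forall e' : {scalar E}, continuous e' -> e' x = e' y) -> x = y.
Proof.
move=> hE exy; apply: hE => A B /nbhs_seminorm[p [ps pc pA]] yB.
have [e' [e'p e'x]] := seminorm_attained (y - x) ps.
have pyx : p (y - x) = 0.
  by rewrite -e'x linearB exy ?subrr//; exact: scalar_continuous e'p.
exists y; split; last exact: nbhs_singleton.
by apply: pA; rewrite pyx.
Qed.

Lemma cvg_seminorm (T : Type) (F : set_system T) (f : T -> E) x : Filter F ->
  (forall p, seminorm p -> continuous p -> forall e : R, 0 < e ->
    \forall t \near F, p (f t - x) < e) -> f @ F --> x.
Proof.
move=> FF fp A /nbhs_seminorm[p [ps pc pA]].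
by apply: (@filterS _ F FF _ (f @^-1` A) _ (fp p ps pc 1 ltr01)) => t; exact: pA.
Qed.

Lemma cvg_seminormP (T : Type) (F : set_system T) (f : T -> E) x p (e : R) :
  Filter F -> seminorm p -> continuous p -> 0 < e -> f @ F --> x ->
  \forall t \near F, p (f t - x) < e.
Proof.
move=> FF ps pc e0 fx; exact: (fx [set y | p (y - x) < e] (seminorm_ball x ps pc e0)).
Qed.

End seminorm_topology.

(** * Mackey's theorem on weakly bounded sets *)

Section geometric_limit.
Context {R : realType}.

Lemma eq0_geometric (x C : R) : (forall n, `|x| <= C * 3^-1 ^+ n) -> x = 0.
Proof.
move=> xC; apply/eqP; rewrite -normr_eq0 eq_le normr_ge0 andbT.
rewrite leNgt; apply/negP => x0.
have C0 : 0 <= C by have := xC 0%N; rewrite expr0 mulr1; lra.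
pose n := (Num.truncn (C / `|x|)).+1.
have nC : C < n%:R * `|x| by rewrite -ltr_pdivrMr// truncnS_gt.
have n3 : n%:R <= (3 : R) ^+ n by rewrite -natrX ler_nat ltnW// ltn_expl.
have := xC n; rewrite exprVn ler_pdivlMr ?exprn_gt0//.
have := ler_wpM2r (ltW x0) n3; lra.
Qed.

(** The intervals [s n - K n, s n + K n] with K n = 3 / 2 * c * 3^-n are
    nested, 3 / 2 being the sum of the powers of 1 / 3; the limit is the supremum
    of their left ends. *)
Lemma geometric_limit (s : nat -> R) (c : R) : 0 <= c ->
  (forall n, `|s n.+1 - s n| <= c * 3^-1 ^+ n) ->
  exists l, forall n, `|l - s n| <= 3 / 2 * c * 3^-1 ^+ n.
Proof.
move=> c0 sc; pose K n : R := 3 / 2 * c * 3^-1 ^+ n.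
have K0 n : 0 <= K n by rewrite !mulr_ge0// exprn_ge0// invr_ge0.
have sK n k : `|s (n + k)%N - s n| <= K n - K (n + k)%N.
  elim: k => [|k IH]; first by rewrite addn0 !subrr normr0.
  rewrite addnS; have := sc (n + k)%N.
  have -> : c * 3^-1 ^+ (n + k) = K (n + k)%N - K (n + k).+1.
    by rewrite /K exprS; lra.
  by rewrite !ler_norml => /andP[? ?]; move: IH; rewrite !ler_norml => /andP[? ?];
    apply/andP; split; lra.
have ab m n : s m - K m <= s n + K n.
  have [mn|nm] := leqP m n.
    have := sK m (n - m)%N; rewrite subnKC// ler_norml => /andP[? ?].
    by have := K0 n; lra.
  have := sK n (m - n)%N; rewrite subnKC ?(ltnW nm)// ler_norml => /andP[? ?].
  by have := K0 m; lra.
pose A := [set s n - K n | n in [set: nat]].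
have hA : has_sup A.
  by split; [exists (s 0%N - K 0%N), 0%N|exists (s 0%N + K 0%N) => _ [n _ <-]].
exists (sup A) => n; rewrite -/(K n) ler_norml; apply/andP; split.
  have /(sup_upper_bound hA) : A (s n - K n) by exists n.
  by lra.
have : sup A <= s n + K n by apply: ge_sup => [|_ [m _ <-]//]; case: hA.
by lra.
Qed.

End geometric_limit.

Section mackey.
Context {R : realType} {E : tvsType R[i]}.
Implicit Types (p : E -> R) (B : set E).
Import Normc.

Definition weakly_bounded B := forall e' : {scalar E}, continuous e' ->
  exists M : R, forall x, B x -> normc (e' x) <= M.

(** A gliding hump.  If p were unbounded on B, choose b_n in B with
    p (b_n) > n 3^n and signed norming functionals v_n, |v_n| <= p, such that
    the partial sums S_n of sum_n 3^-n v_n satisfy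
    |S_(n+1) (b_n)| >= 3^-n p (b_n).  The tail of the series after that term is
    at most half of this at b_n, so the sum u has |u (b_n)| > n / 2 although it
    is dominated by 3 / 2 * p, hence is the real part of a continuous
    functional.  The signed sum is formed with real functionals, where the
    completeness of R gives the limit. *)
Lemma weakly_bounded_seminorm B p : weakly_bounded B ->
  seminorm p -> continuous p -> exists M : R, forall x, B x -> p x <= M.
Proof.
move=> wB ps pc; apply: contrapT => unb.
have /choice[b bP] n : exists x, B x /\ n%:R * 3 ^+ n < p x.
  apply: contrapT => nb; apply: unb; exists (n%:R * 3 ^+ n) => x Bx.
  by rewrite leNgt; apply/negP => h; apply: nb; exists x.
pose rlin (u : E -> R) := (forall x y, u (x + y) = u x + u y) /\
  (forall (r : R) x, u (r%:C *: x) = r * u x).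
pose q n : R := 3^-1 ^+ n.
have q0 n : 0 < q n by rewrite exprn_gt0.
have step (un : (E -> R) * nat) : exists v : E -> R,
    [/\ rlin v, forall x, `|v x| <= p x &
      q un.2 * p (b un.2) <= `|un.1 (b un.2) + q un.2 * v (b un.2)|].
  case: un => u n /=; have [e' [e'p e'b]] := seminorm_attained (b n) ps.
  have rl : rlin (fun x => complex.Re (e' x)).
    by split=> [x y|r x]; rewrite ?linearD ?ReD// linearZ/= ReM_real.
  (* The sign of v is that of u (b n), so that the two terms cannot cancel. *)
  have [h|h] := leP 0 (u (b n)).
    exists (fun x => complex.Re (e' x)); split=> //.
      by move=> x; apply: le_trans (normc_Re _) (e'p x).
    by rewrite e'b; apply: le_trans (ler_norm _); lra.
  exists (fun x => - complex.Re (e' x)); split.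
  - by split=> [x y|r x]; rewrite ?rl.1 ?rl.2; lra.
  - by move=> x; rewrite normrN; apply: le_trans (normc_Re _) (e'p x).
  - by rewrite e'b -normrN; apply: le_trans (ler_norm _); lra.
have [V VP] := choice step.
pose S := fix S n : E -> R :=
  if n is m.+1 then fun x => S m x + q m * V (S m, m) x else fun=> 0.
have Slin n : rlin (S n).
  elim: n => [|n [SD SZ]]; first by split=> *; rewrite /= ?addr0 ?mulr0.
  have [[VD VZ] _ _] := VP (S n, n).
  by split=> *; rewrite /= ?SD ?VD ?SZ ?VZ; ring.
have Sc x n : `|S n.+1 x - S n x| <= p x * 3^-1 ^+ n.
  rewrite /= addrAC subrr add0r normrM ger0_norm ?(ltW (q0 _))// mulrC.
  by rewrite ler_wpM2r ?(ltW (q0 _))//; have [] := VP (S n, n).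
have /choice[u uP] x : exists l, forall n, `|l - S n x| <= 3 / 2 * p x * 3^-1 ^+ n.
  exact: geometric_limit (seminorm_ge0 x ps) (Sc x).
have ulin : rlin u.
  split=> [x y|r x]; apply/eqP; rewrite -subr_eq0; apply/eqP.
    apply: (@eq0_geometric _ _ (3 / 2 * (p (x + y) + p x + p y))) => n.
    have -> : u (x + y) - (u x + u y) = (u (x + y) - S n (x + y)) -
        (u x - S n x) - (u y - S n y) by rewrite (Slin n).1; ring.
    apply: le_trans (ler_normB _ _) _; apply: le_trans (lerD (ler_normB _ _) (lexx _)) _.
    by have := uP x n; have := uP y n; have := uP (x + y) n; lra.
  apply: (@eq0_geometric _ _ (3 / 2 * (p (r%:C *: x) + `|r| * p x))) => n.
  have -> : u (r%:C *: x) - r * u x = (u (r%:C *: x) - S n (r%:C *: x)) -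
      r * (u x - S n x) by rewrite (Slin n).2; ring.
  apply: le_trans (ler_normB _ _) _; rewrite normrM.
  have := ler_wpM2l (normr_ge0 r) (uP x n); have := uP (r%:C *: x) n.
  by lra.
have up x : `|u x| <= 3 / 2 * p x.
  by have := uP x 0%N; rewrite /= subr0 expr0 mulr1.
have h32 : 0 <= 3 / 2 :> R by [].
have [p's p'c] := seminormM h32 ps pc.
have [e' [e'u e'p]] := complexify p's ulin.1 ulin.2 up.
have [M MP] := wB e' (scalar_continuous p's p'c e'p).
pose n := (Num.truncn (2 * M)).+1.
have nM : 2 * M < n%:R by rewrite truncnS_gt.
have [Bb pb] := bP n.
have := le_trans (normc_Re _) (MP _ Bb); rewrite e'u => ubM.
have [_ _ Vb] := VP (S n, n); have := uP (b n) n.+1.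
have {}pb : n%:R < q n * p (b n).
  by rewrite /q exprVn mulrC ltr_pdivlMr ?exprn_gt0.
have : q n * p (b n) <= `|S n.+1 (b n)| by [].
have : `|S n.+1 (b n)| <= `|u (b n)| + `|u (b n) - S n.+1 (b n)|.
  by rewrite [X in _ <= _ + X]distrC -lerBlDl; apply: lerB_dist.
have -> : 3 / 2 * p (b n) * 3^-1 ^+ n.+1 = 2^-1 * (q n * p (b n)).
  by rewrite /q exprS; field.
by lra.
Qed.

(** Every neighborhood of 0 contains a ball of a continuous seminorm, and those
    are bounded on B. *)
Lemma weakly_bounded_bounded B : weakly_bounded B -> tvs_bounded B.
Proof.
move=> wB U /nbhs0_seminorm[p [ps pc pU]].
have [M MP] := weakly_bounded_seminorm wB ps pc.
have r0 : 0 < `|M| + 1 by have := normr_ge0 M; lra.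
exists (`|M| + 1) => // x /MP px; exists ((`|M| + 1)^-1%:C *: x).
  apply: pU; rewrite seminormZr ?invr_ge0 ?ltW// mulrC ltr_pdivrMr// mul1r.
  by have := ler_norm M; lra.
by rewrite scalerA -rmorphM mulfV ?gt_eqF// scale1r.
Qed.

End mackey.

(** * Bipolars and completeness *)

Section bipolar.
Context {R : realType} {E : tvsType R[i]}.
Implicit Types (B : set E) (x y : E).
Import Normc.
Local Open Scope convex_scope.

Definition polar_le B (e' : {scalar E}) (M : R) := forall x, B x -> normc (e' x) <= M.

(** Membership is a condition on functionals only, so that the estimates in
    E_(bipolar B) reduce to scalar ones without separating points from disks. *)
Definition bipolar B : set E :=
  [set x | forall e' : {scalar E}, continuous e' -> polar_le B e' 1 -> normc (e' x) <= 1].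

Lemma scalar_scale (c : R[i]) (e' : {scalar E}) : continuous e' ->
  exists f : {scalar E}, continuous f /\ forall x, f x = c * e' x.
Proof.
move=> e'c; pose f x := c * e' x.
have flin : linear_for *%R f.
  by move=> k x y; rewrite /f linearP /= mulrDr mulrCA.
pose g : {scalar E} := HB.pack f (GRing.isLinear.Build _ _ _ _ f flin).
exists g; split; last by [].
have [ps pc] := scalar_seminorm e'c.
have [ps' pc'] := seminormM (normc_ge0 c) ps pc.
by apply: (scalar_continuous ps' pc') => x; rewrite -normcM.
Qed.

Lemma bipolar_le B (e' : {scalar E}) (M : R) :
  0 < M -> continuous e' -> polar_le B e' M ->
  polar_le (bipolar B) e' M.
Proof.
move=> M0 e'c BM x Bx; have [f [fc fE]] := scalar_scale (M^-1)%:C e'c.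
have : normc (f x) <= 1.
  apply: Bx => // y By.
  by rewrite fE normcM normcV_real// ler_pdivrMl// mulr1; exact: BM.
by rewrite fE normcM normcV_real// ler_pdivrMl// mulr1.
Qed.

Lemma bipolar_scale B x (r : R) : 0 < r ->
  (forall e' : {scalar E}, continuous e' -> polar_le B e' 1 -> normc (e' x) <= r) ->
  exists2 y, bipolar B y & x = r%:C *: y.
Proof.
move=> r0 xr; exists ((r^-1)%:C *: x).
  move=> e' e'c e'B; rewrite linearZ/= normcM normcV_real// ler_pdivrMl// mulr1.
  exact: xr.
by rewrite scalerA -rmorphM mulfV ?gt_eqF// scale1r.
Qed.

Lemma bipolar_span B x (r : R) :
  (forall e' : {scalar E}, continuous e' -> polar_le B e' 1 -> normc (e' x) <= r) ->
  disk_span (bipolar B) x.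
Proof.
move=> xr; have rn := truncnS_gt r.
have [|e' e'c e'B|y By xy] := @bipolar_scale B x (Num.truncn r).+1%:R.
- by rewrite ltr0n.
- by apply: le_trans (xr e' e'c e'B) (ltW rn).
- by exists (Num.truncn r).+1, y => //; rewrite xy rmorph_nat.
Qed.

Lemma span_bipolar B x : disk_span (bipolar B) x -> exists r : R,
  forall e' : {scalar E}, continuous e' -> polar_le B e' 1 -> normc (e' x) <= r.
Proof.
move=> [n [y By ->]]; exists n%:R => e' e'c e'B.
rewrite linearZ/= normcM -(rmorph_nat (real_complex R)) normcR ger0_norm//.
by rewrite ler_piMr//; exact: By.
Qed.

Lemma closed_bipolar B : closed (bipolar B).
Proof.
move=> x clx e' e'c e'B; rewrite leNgt; apply/negP => e'x.
have [ps pc] := scalar_seminorm e'c.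
have e0 : 0 < normc (e' x) - 1 by lra.
have [y [By /=]] := clx _ (seminorm_ball x ps pc e0).
have := By e' e'c e'B; have := seminorm_dist y x ps.
by rewrite ler_norml => /andP[? ?]; lra.
Qed.

(** A functional bounded on B has the same bound on the bipolar, which is thus
    weakly bounded, hence bounded. *)
Lemma disk_bipolar B : weakly_bounded B -> disk (bipolar B).
Proof.
move=> wB; split; last split.
- apply: weakly_bounded_bounded => e' e'c; have [M MP] := wB e' e'c.
  have M0 : 0 < `|M| + 1 by have := normr_ge0 M; lra.
  exists (`|M| + 1); apply: bipolar_le => // x /MP; have := ler_norm M.
  by lra.
- move=> x y l /set_mem Bx /set_mem By; apply/mem_set => e' e'c e'B.
  have := Bx e' e'c e'B; have := By e' e'c e'B.
  rewrite -[_ <| _ |> _]/(l%:num *: (x : E) + (1 - l%:num) *: (y : E))%R.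
  rewrite linearD !linearZ/= => hy hx.
  apply: le_trans (normc_triangle _ _) _; rewrite !normcM.
  have l0 : 0 <= l%:num :> R[i] by [].
  have l1 : l%:num <= 1 :> R[i] by [].
  move: (l%:num) l0 l1 => k k0 k1.
  have kE : k = (complex.Re k)%:C by rewrite RRe_real// ger0_real.
  move: k0 k1; rewrite kE (lecR 0) (lecR _ 1) => l0 l1.
  rewrite -(rmorph1 (real_complex R)) -rmorphB !normcR.
  rewrite !ger0_norm ?subr_ge0//.
  have := ler_wpM2l l0 hx; have hl : 0 <= 1 - complex.Re k by rewrite subr_ge0.
  by have := ler_wpM2l hl hy; lra.
- move=> c x c1 Bx e' e'c e'B; rewrite linearZ/= normcM.
  by rewrite mulr_ile1 ?normc_ge0//; [rewrite -lecR|exact: Bx].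
Qed.

Lemma complex_arbitrarily_close (z w : R[i]) :
  (forall e : R, 0 < e -> normc (z - w) <= e) -> z = w.
Proof.
move=> zw; apply/eqP; rewrite -subr_eq0; apply/eqP/eq0_normc/eqP.
by rewrite eq_le normc_ge0 andbT; apply/ler_addgt0Pr => e /zw; rewrite add0r.
Qed.

Lemma small_invn (c e : R) : 0 <= c -> 0 < e ->
  exists N : nat, forall n, (N <= n)%N -> c / n.+1%:R < e.
Proof.
move=> c0 e0; exists (Num.truncn (c / e)) => n Nn.
rewrite ltr_pdivrMr ?ltr0n// mulrC -ltr_pdivrMr//.
by apply: lt_le_trans (truncnS_gt _) _; rewrite ler_nat ltnS.
Qed.

(** The rate c * M / n.+1 is uniform over the functionals bounded by M on B;
    this says that S is Cauchy for the gauge of the bipolar K.  A limit in E_K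
    is a weak limit, each functional being bounded on K.  The bound r keeps the
    S n in the span of K. *)
Lemma weak_limit_exists B (S : nat -> E) (I : {scalar E} -> R[i]) (r c : R) :
  locally_complete E -> weakly_bounded B -> 0 <= c ->
  (forall n (e' : {scalar E}) M, continuous e' -> polar_le B e' M ->
     normc (e' (S n)) <= r * M) ->
  (forall n (e' : {scalar E}) M, continuous e' -> polar_le B e' M ->
     normc (e' (S n) - I e') <= c * M / n.+1%:R) ->
  exists x, forall e' : {scalar E}, continuous e' -> e' x = I e'.
Proof.
move=> lcE wB c0 Sr Sc; pose K := bipolar B.
have KS n : disk_span K (S n).
  by apply: (@bipolar_span _ _ r) => e' e'c /(Sr n e' _ e'c); rewrite mulr1.
have Scauchy (e : R) : 0 < e -> exists N : nat, forall m n : nat,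
    (N <= m)%N -> (N <= n)%N -> gauge K (S m - S n) < e.
  move=> e0; have e20 : 0 < e / 3 by rewrite divr_gt0.
  have [N NP] := small_invn c0 e20; exists N => m n Nm Nn.
  have := NP _ Nm; have := NP _ Nn => cn cm.
  have [|e' e'c e'B|y Ky yE] := @bipolar_scale B (S m - S n) (e / 3 + e / 3).
  - by lra.
  - have := Sc m e' _ e'c e'B; have := Sc n e' _ e'c e'B; rewrite mulr1 => hn hm.
    rewrite linearB/= -(subrK (I e') (e' (S m))) -addrA.
    apply: le_trans (normc_triangle _ _) _; rewrite [normc (I e' - _)]normcB.
    by apply: lerD; apply: ltW; [exact: le_lt_trans hm cm|exact: le_lt_trans hn cn].
  - have := gauge_le (_ : 0 < e / 3 + e / 3) Ky yE; move=> /(_ ltac:(lra)).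
    by lra.
have [x Kx xP] := lcE K (@closed_bipolar B) (disk_bipolar wB) S KS Scauchy.
exists x => e' e'c; have [M0 M0P] := wB e' e'c.
pose M := `|M0| + 1.
have M_gt0 : 0 < M by rewrite /M; have := normr_ge0 M0; lra.
have MP : polar_le B e' M.
  by move=> b /M0P; rewrite /M; have := ler_norm M0; lra.
apply: complex_arbitrarily_close => e e0.
have eM0 : 0 < e / 2 / M by rewrite !divr_gt0.
have e20 : 0 < e / 2 by rewrite !divr_gt0.
have [N1 N1P] := xP _ eM0.
have [N2 N2P] := small_invn (mulr_ge0 c0 (ltW M_gt0)) e20.
pose n := maxn N1 N2; have := N1P n (leq_maxl _ _); have := N2P n (leq_maxr _ _).
move=> h2 h1.
have [s sP] : exists s : R, forall e' : {scalar E}, continuous e' -> polar_le B e' 1 ->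
    normc (e' (S n - x)) <= s.
  have [r1 r1P] := span_bipolar Kx; have [r2 r2P] := span_bipolar (KS n).
  exists (r2 + r1) => f fc fB; rewrite linearB/=.
  apply: le_trans (normc_triangle _ _) _; rewrite normc_opp.
  by rewrite lerD ?r1P ?r2P.
have s0 : 0 < `|s| + 1 by have := normr_ge0 s; lra.
have Sx : exists2 y, K y & S n - x = (`|s| + 1)%:C *: y.
  apply: bipolar_scale => // f fc fB; have := sP f fc fB; have := ler_norm s.
  by lra.
have [t [y [t0 te Ky yE]]] := gauge_lt s0 Sx h1.
have -> : e' x - I e' = (e' (S n) - I e') - e' (S n - x) by rewrite linearB/=; ring.
apply: le_trans (normc_triangle _ _) _; rewrite normc_opp yE linearZ/= normcM normcR.
rewrite ger0_norm ?(ltW t0)//.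
have := bipolar_le M_gt0 e'c MP Ky => e'y.
have ty : t * normc (e' y) <= e / 2.
  apply: le_trans (ler_wpM2l (ltW t0) e'y) _.
  by rewrite -ler_pdivlMr// ltW.
apply: le_trans (lerD (le_trans (Sc n e' M e'c MP) (ltW h2)) ty) _.
by lra.
Qed.

End bipolar.

(** * Integrals of bounded measurable complex functions *)

Section bounded_measurable.
Context {R : realType} (d : measure_display) (T : measurableType d).
Variables (mu : {measure set T -> \bar R}) (D : set T).
Hypotheses (mD : measurable D) (muD : (mu D < +oo)%E).
Implicit Types (phi psi : T -> R[i]).
Import Normc.

Definition cmeasurable phi :=
  measurable_fun D (fun t => complex.Re (phi t)) /\
  measurable_fun D (fun t => complex.Im (phi t)).

Definition bounded_measurable phi :=
  cmeasurable phi /\ exists M : R, forall t, D t -> normc (phi t) <= M.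

Lemma bounded_measurable_cst c : bounded_measurable (fun=> c).
Proof. by split; [split; exact: measurable_cst|exists (normc c)]. Qed.

Lemma bounded_measurableD phi psi : bounded_measurable phi ->
  bounded_measurable psi -> bounded_measurable (fun t => phi t + psi t).
Proof.
move=> [[fr fi] [M fM]] [[gr gi] [N gN]]; split; last first.
  exists (M + N) => t Dt; apply: le_trans (normc_triangle _ _) _.
  by apply: lerD; [exact: fM|exact: gN].
split.
- by under eq_fun do rewrite ReD; exact: measurable_funD.
- by under eq_fun do rewrite ImD; exact: measurable_funD.
Qed.

Lemma bounded_measurableM phi psi : bounded_measurable phi ->
  bounded_measurable psi -> bounded_measurable (fun t => phi t * psi t).
Proof.
move=> [[fr fi] [M fM]] [[gr gi] [N gN]]; split; last first.
  exists (M * N) => t Dt; rewrite normcM.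
  by apply: ler_pM; rewrite ?normc_ge0 ?fM ?gN.
have ReM (z w : R[i]) : complex.Re (z * w) =
  complex.Re z * complex.Re w - complex.Im z * complex.Im w by case: z w => [? ?] [? ?].
have ImM (z w : R[i]) : complex.Im (z * w) =
  complex.Re z * complex.Im w + complex.Im z * complex.Re w by case: z w => [? ?] [? ?].
split.
- under eq_fun do rewrite ReM.
  by apply: measurable_funB; exact: measurable_funM.
- under eq_fun do rewrite ImM.
  by apply: measurable_funD; exact: measurable_funM.
Qed.

Lemma bounded_measurable_sum (I : Type) (s : seq I) (F : I -> T -> R[i]) :
  (forall i, bounded_measurable (F i)) ->
  bounded_measurable (fun t => \sum_(i <- s) F i t).
Proof.
move=> mF; elim: s => [|i s IH].
  by under eq_fun do rewrite big_nil; exact: bounded_measurable_cst.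
by under eq_fun do rewrite big_cons; exact: bounded_measurableD.
Qed.

Lemma bounded_measurable_prod (I : Type) (s : seq I) (F : I -> T -> R[i]) :
  (forall i, bounded_measurable (F i)) ->
  bounded_measurable (fun t => \prod_(i <- s) F i t).
Proof.
move=> mF; elim: s => [|i s IH].
  by under eq_fun do rewrite big_nil; exact: bounded_measurable_cst.
by under eq_fun do rewrite big_cons; exact: bounded_measurableM.
Qed.

Lemma bounded_measurable_indic (A : set T) (b : T -> bool) : measurable A ->
  (forall t, b t <-> A t) -> bounded_measurable (fun t => (b t)%:R).
Proof.
move=> mA bA; have bE t : (b t)%:R = (\1_A t)%:C :> R[i].
  rewrite indicE rmorph_nat; congr (_%:R); congr nat_of_bool.
  by apply/idP/idP => [/bA/mem_set|/set_mem/bA].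
split; last first.
  exists 1 => t _; rewrite bE normcR indicE.
  by case: (_ \in _); rewrite ?normr1 ?normr0.
split; under eq_fun do rewrite bE /=; first exact: measurable_indic.
exact: measurable_cst.
Qed.

(** Such a function is a finite linear combination of indicators. *)
Lemma bounded_measurable_step (I : finType) (c : T -> I) (v : I -> R[i]) :
  (forall i, measurable (c @^-1` [set i])) ->
  bounded_measurable (fun t => v (c t)).
Proof.
move=> mc; have vE t : v (c t) = \sum_i v i * (c t == i)%:R.
  rewrite (bigD1 (c t))//= eqxx mulr1 big1 ?addr0// => i.
  by rewrite eq_sym => /negbTE ->; rewrite mulr0.
under eq_fun do rewrite vE.
apply: bounded_measurable_sum => i.
apply: bounded_measurableM; first exact: bounded_measurable_cst.
by apply: bounded_measurable_indic (mc i) _ => t; split=> /eqP.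
Qed.

Lemma cmeasurable_limit phi (h : nat -> T -> R[i]) (M : R) :
  (forall n, cmeasurable (h n)) ->
  (forall n t, D t -> normc (phi t - h n t) <= M / n.+1%:R) ->
  cmeasurable phi.
Proof.
move=> mh hphi; have M0 t : D t -> 0 <= M.
  by move=> Dt; have := hphi 0%N t Dt; rewrite divr1; apply: le_trans; exact: normc_ge0.
split.
- apply: (@measurable_fun_cvg _ _ _ _ (fun n t => complex.Re (h n t))) => [n|t Dt].
    exact: (mh n).1.
  apply/cvgrPdist_lt => e e0; have [N NP] := small_invn (M0 t Dt) e0.
  exists N => // n /= Nn; rewrite -ReB; apply: le_lt_trans (normc_Re _) _.
  exact: le_lt_trans (hphi n t Dt) (NP n Nn).
- apply: (@measurable_fun_cvg _ _ _ _ (fun n t => complex.Im (h n t))) => [n|t Dt].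
    exact: (mh n).2.
  apply/cvgrPdist_lt => e e0; have [N NP] := small_invn (M0 t Dt) e0.
  exists N => // n /= Nn; rewrite -ImB; apply: le_lt_trans (normc_Im _) _.
  exact: le_lt_trans (hphi n t Dt) (NP n Nn).
Qed.

Lemma bounded_measurable_integrable phi : bounded_measurable phi ->
  cintegrable mu D phi.
Proof.
have key (u : T -> R) : measurable_fun D u ->
    (exists M : R, forall t, D t -> `|u t| <= M) -> mu.-integrable D (EFin \o u).
  move=> mu_ [M uM]; apply: measurable_bounded_integrable => //.
  exists M; split; first exact: num_real.
  by move=> N MN t Dt; apply: le_trans (uM t Dt) (ltW MN).
move=> [[fr fi] [M fM]]; split; apply: key => //.
- by exists M => t Dt; apply: le_trans (normc_Re _) (fM t Dt).
- by exists M => t Dt; apply: le_trans (normc_Im _) (fM t Dt).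
Qed.

Lemma eq_cintegral phi psi : (forall t, D t -> phi t = psi t) ->
  cintegral mu D phi = cintegral mu D psi.
Proof.
by move=> fg; congr (_ +i* _); apply: eq_Rintegral => t /set_mem Dt; rewrite fg.
Qed.

Lemma cintegralD phi psi : bounded_measurable phi -> bounded_measurable psi ->
  cintegral mu D (fun t => phi t + psi t) =
  cintegral mu D phi + cintegral mu D psi.
Proof.
move=> /bounded_measurable_integrable[fr fi].
move=> /bounded_measurable_integrable[gr gi]; rewrite /cintegral.
under [X in Complex X _]eq_Rintegral do rewrite ReD.
under [X in Complex _ X]eq_Rintegral do rewrite ImD.
by rewrite !RintegralD.
Qed.

Lemma cintegralZ c phi : bounded_measurable phi ->
  cintegral mu D (fun t => phi t * c) = cintegral mu D phi * c.
Proof.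
move=> /bounded_measurable_integrable[fr fi]; case: c => x y; rewrite /cintegral.
have ReM (z : R[i]) : complex.Re (z * (x +i* y)) =
  complex.Re z * x - complex.Im z * y by case: z.
have ImM (z : R[i]) : complex.Im (z * (x +i* y)) =
  complex.Re z * y + complex.Im z * x by case: z.
have iZ (u : T -> R) (k : R) : mu.-integrable D (EFin \o u) ->
    mu.-integrable D (EFin \o (fun t => u t * k)).
  by move=> iu; apply: eq_integrable (integrableZr mD k iu).
under [X in Complex X _]eq_Rintegral do rewrite ReM.
under [X in Complex _ X]eq_Rintegral do rewrite ImM.
by rewrite RintegralB ?RintegralD ?RintegralZr//; exact: iZ.
Qed.

Lemma cintegral0 : cintegral mu D (fun=> 0) = 0.
Proof. by rewrite /cintegral !Rintegral_cst// mul0r. Qed.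

Lemma cintegralB phi psi : bounded_measurable phi -> bounded_measurable psi ->
  cintegral mu D (fun t => phi t - psi t) =
  cintegral mu D phi - cintegral mu D psi.
Proof.
move=> mf mg; have mN : bounded_measurable (fun t => psi t * -1).
  by apply: bounded_measurableM => //; exact: bounded_measurable_cst.
rewrite -mulrN1 -cintegralZ// -cintegralD//.
by apply: eq_cintegral => t _; rewrite mulrN1.
Qed.

Lemma cintegral_sum (I : Type) (s : seq I) (F : I -> T -> R[i]) :
  (forall i, bounded_measurable (F i)) ->
  cintegral mu D (fun t => \sum_(i <- s) F i t) =
  \sum_(i <- s) cintegral mu D (F i).
Proof.
move=> mF; elim: s => [|i s IH].
  by rewrite big_nil -[RHS]cintegral0; apply: eq_cintegral => t _; rewrite big_nil.
rewrite big_cons -IH -cintegralD//; last exact: bounded_measurable_sum.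
by apply: eq_cintegral => t _; rewrite big_cons.
Qed.

(** The factor 2 comes from bounding the real and imaginary parts
    separately. *)
Lemma normc_cintegral phi (M : R) : bounded_measurable phi ->
  (forall t, D t -> normc (phi t) <= M) ->
  normc (cintegral mu D phi) <= 2 * M * fine (mu D).
Proof.
move=> /bounded_measurable_integrable[fr fi] fM.
have key (u : T -> R) : mu.-integrable D (EFin \o u) ->
    (forall t, D t -> `|u t| <= M) -> `|Rintegral mu D u| <= M * fine (mu D).
  move=> iu uM; apply: le_trans (le_normr_Rintegral mD iu) _.
  rewrite -Rintegral_cst//; apply: le_Rintegral => //.
  - exact: (integrable_norm iu).
  - by apply: measurable_bounded_integrable => //; exact: bounded_cst.
apply: le_trans (normc_ReIm _) _ => /=.
have := key _ fr (fun t Dt => le_trans (normc_Re _) (fM t Dt)).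
have := key _ fi (fun t Dt => le_trans (normc_Im _) (fM t Dt)).
by lra.
Qed.

End bounded_measurable.

(** * Weak integrals of vector-valued functions *)

Section weak_integral.
Context {R : realType} {E : tvsType R[i]} (d : measure_display).
Context (T : measurableType d) (mu : {measure set T -> \bar R}) (D : set T).
Hypotheses (mD : measurable D) (muD : (mu D < +oo)%E).
Variable w : T -> R[i].
Hypothesis mw : bounded_measurable D w.
Implicit Types (phi psi : T -> E) (x y : E).
Import Normc.

(** The Pettis integral of phi * w.  The weight stays apart from phi, so that
    linearity and seminorm estimates concern phi alone; boundedness and
    measurability replace integrability. *)
Definition weak_integral phi x := forall e' : {scalar E}, continuous e' ->
  bounded_measurable D (fun t => e' (phi t)) /\
  e' x = cintegral mu D (fun t => e' (phi t) * w t).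

(** The n-th Riemann sum replaces phi on each cell by its value at the point
    pt of that cell.  Because n.+1 times the error lies in B, a functional
    bounded by M on B sees an error at most M / n.+1; this gives at once the
    measurability of e' o phi, as a limit of step functions, and the
    hypotheses of [weak_limit_exists]. *)
Lemma weak_integral_exists phi (B : set E) :
  locally_complete E -> weakly_bounded B ->
  (forall t, D t -> B (phi t)) ->
  (forall n, exists (I : finType) (c : T -> I) (pt : I -> T),
    (forall i, measurable (c @^-1` [set i])) /\
    forall t, D t -> D (pt (c t)) /\ B (n.+1%:R *: (phi t - phi (pt (c t))))) ->
  exists x, weak_integral phi x.
Proof.
move=> lcE wB phiB grid; have [_ [C0 wC0]] := mw.
pose C := `|C0|; have C_ge0 : 0 <= C := normr_ge0 _.
have wC t : D t -> normc (w t) <= C.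
  by move=> /wC0 h; apply: le_trans h (ler_norm _).
have mu0 : 0 <= fine (mu D) by rewrite fine_ge0.
have approx n : exists hs : ({scalar E} -> T -> R[i]) * E, forall e' : {scalar E},
    [/\ bounded_measurable D (hs.1 e'), forall M t, polar_le B e' M -> D t ->
       normc (e' (phi t) - hs.1 e' t) <= M / n.+1%:R /\ normc (hs.1 e' t) <= M &
       e' hs.2 = cintegral mu D (fun t => hs.1 e' t * w t)].
  have [I [c [pt [mc cpt]]]] := grid n.
  pose b i t : R[i] := (c t == i)%:R * w t.
  have mb i : bounded_measurable D (b i).
    apply: bounded_measurableM => //.
    by apply: bounded_measurable_indic (mc i) _ => t; split=> /eqP.
  exists (fun (e' : {scalar E}) t => e' (phi (pt (c t))),
          \sum_i cintegral mu D (b i) *: phi (pt i)) => e'; split=> /=.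
  - exact: (bounded_measurable_step D (fun i => e' (phi (pt i)))).
  - move=> M t e'M Dt; have [Dpt Bt] := cpt t Dt; split; last exact/e'M/phiB.
    rewrite -linearB ler_pdivlMr ?ltr0n// mulrC.
    have := e'M _ Bt; rewrite linearZ/= normcM -(rmorph_nat (real_complex R)).
    by rewrite normcR ger0_norm.
  - rewrite linear_sum/=; under eq_bigr do rewrite linearZ/= -cintegralZ//.
    rewrite -cintegral_sum//; last first.
      by move=> i; apply: bounded_measurableM => //; exact: bounded_measurable_cst.
    apply: eq_cintegral => t _; rewrite (bigD1 (c t))//= big1 ?addr0.
      by rewrite /b eqxx mul1r mulrC.
    by move=> i; rewrite /b eq_sym => /negbTE ->; rewrite !mul0r.
have {approx}[hs hsP] := choice approx.
have mphi (e' : {scalar E}) : continuous e' ->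
    bounded_measurable D (fun t => e' (phi t)).
  move=> e'c; have [M MP] := wB e' e'c; split; last first.
    by exists M => t /phiB; exact: MP.
  apply: (@cmeasurable_limit _ _ _ _ _ (fun n => (hs n).1 e') M) => [n|n t Dt].
    by have [[]] := hsP n e'.
  by have [_ /(_ M t MP Dt) [] ] := hsP n e'.
pose I (e' : {scalar E}) := cintegral mu D (fun t => e' (phi t) * w t).
pose K := 2 * C * fine (mu D).
have K0 : 0 <= K by rewrite !mulr_ge0.
have [||x xI] := @weak_limit_exists _ _ B (fun n => (hs n).2) I K K lcE wB K0.
- move=> n e' M e'c e'M; have [mh hM ->] := hsP n e'.
  rewrite (_ : K * M = 2 * (M * C) * fine (mu D)); last by rewrite /K; ring.
  apply: normc_cintegral => //; first exact: bounded_measurableM.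
  move=> t Dt; rewrite normcM ler_pM ?normc_ge0//; last exact: wC.
  by have [] := hM M t e'M Dt.
- move=> n e' M e'c e'M; have [mh hM ->] := hsP n e'.
  rewrite (_ : K * M / n.+1%:R = 2 * (M / n.+1%:R * C) * fine (mu D)); last first.
    by rewrite /K; ring.
  rewrite /I -cintegralB//; [|exact: bounded_measurableM|]; last first.
    by apply: bounded_measurableM => //; exact: mphi.
  apply: normc_cintegral => //.
    apply: bounded_measurableD; first exact: bounded_measurableM.
    under eq_fun do rewrite -mulN1r; apply: bounded_measurableM.
      exact: bounded_measurable_cst.
    by apply: bounded_measurableM => //; exact: mphi.
  move=> t Dt; rewrite -mulrBl normcM ler_pM ?normc_ge0//; last exact: wC.
  by rewrite normcB; have [] := hM M t e'M Dt.
by exists x => e' e'c; split; [exact: mphi|exact: xI].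
Qed.

Lemma weak_integralB phi psi x y : weak_integral phi x -> weak_integral psi y ->
  weak_integral (fun t => phi t - psi t) (x - y).
Proof.
move=> ix iy e' e'c; have [mf xE] := ix e' e'c; have [mg yE] := iy e' e'c.
have fE t : e' (phi t - psi t) = e' (phi t) + (-1) * e' (psi t).
  by rewrite linearB mulN1r.
split.
  under eq_fun do rewrite fE; apply: bounded_measurableD => //.
  by apply: bounded_measurableM => //; exact: bounded_measurable_cst.
rewrite linearB xE yE -cintegralB//; try exact: bounded_measurableM.
by apply: eq_cintegral => t _; rewrite linearB mulrBl.
Qed.

Lemma weak_integralZ c phi x : weak_integral phi x ->
  weak_integral (fun t => c *: phi t) (c *: x).
Proof.
move=> ix e' e'c; have [mf xE] := ix e' e'c; split.
  under eq_fun do rewrite linearZ/=; apply: bounded_measurableM => //.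
  exact: bounded_measurable_cst.
rewrite linearZ/= xE mulrC -cintegralZ//; last exact: bounded_measurableM.
by apply: eq_cintegral => t _; rewrite linearZ/= -mulrA mulrC.
Qed.

(** A functional dominated by p and equal to p at x reduces this to the
    scalar estimate. *)
Lemma weak_integral_seminorm phi x p (e C : R) :
  weak_integral phi x -> seminorm p -> continuous p ->
  (forall t, D t -> p (phi t) <= e) -> (forall t, D t -> normc (w t) <= C) ->
  p x <= 2 * (e * C) * fine (mu D).
Proof.
move=> ix ps pc pe wC; have [e' [e'p <-]] := seminorm_attained x ps.
have e'c := scalar_continuous ps pc e'p.
apply: le_trans (ler_norm _) _; apply: le_trans (normc_Re _) _.
have [mf ->] := ix e' e'c; apply: normc_cintegral => //.
  exact: bounded_measurableM.
move=> t Dt; rewrite normcM ler_pM ?normc_ge0//; last exact: wC.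
exact: le_trans (e'p _) (pe t Dt).
Qed.

End weak_integral.

(** * Mean values, compactness and grids on cubes *)

Section mean_value.
Context {R : realType}.
Import Normc.

Lemma real_mean_value (f f' : R -> R) :
  (forall s : R, 0 <= s <= 1 ->
    (fun h : R => h^-1 * (f (s + h) - f s)) @ 0^' --> f' s) ->
  exists2 c : R, 0 <= c <= 1 & f 1 - f 0 = f' c.
Proof.
move=> fd; have fD (s : R) : 0 <= s <= 1 -> is_derive s 1 f (f' s).
  move=> s01; have fs : (fun h : R => h^-1 *: (f (h *: 1 + s) - f s)) @ 0^' --> f' s.
    apply: cvg_trans (fd s s01); apply: near_eq_cvg; near=> h.
    by rewrite [h *: 1]mulr1 [h + s]addrC.
  by apply: DeriveDef; [apply/cvg_ex; exists (f' s)|exact: cvg_lim fs].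
have [||c] := @MVT_segment _ f f' 0 1 ler01.
- by move=> s; rewrite in_itv/= => /andP[? ?]; apply: fD; rewrite !ltW.
- by apply: derivable_within_continuous => s; rewrite in_itv/= => /fD[].
by rewrite in_itv/= subr0 mulr1; exists c.
Unshelve. all: by end_near. Qed.

(** The mean value theorem fails for complex values, but applies to the real
    and imaginary parts at two different points; whence the factor 2. *)
Lemma complex_mean_value (F F' : R -> R[i]) (c : R[i]) (M : R) :
  (forall s : R, 0 <= s <= 1 ->
    (fun h : R => (h^-1)%:C * (F (s + h) - F s)) @ 0^' --> F' s) ->
  (forall s : R, 0 <= s <= 1 -> normc (F' s - c) <= M) ->
  normc (F 1 - F 0 - c) <= 2 * M.
Proof.
move=> Fd F'c.
have [s s01 sE] : exists2 s : R, 0 <= s <= 1 &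
    complex.Re (F 1) - complex.Re (F 0) = complex.Re (F' s).
  apply: (real_mean_value (f := fun s => complex.Re (F s))
    (f' := fun s => complex.Re (F' s))) => s /Fd /cvg_Re.
  by under eq_fun do rewrite ReM_real ReB.
have [t t01 tE] : exists2 s : R, 0 <= s <= 1 &
    complex.Im (F 1) - complex.Im (F 0) = complex.Im (F' s).
  apply: (real_mean_value (f := fun s => complex.Im (F s))
    (f' := fun s => complex.Im (F' s))) => u /Fd /cvg_Im.
  by under eq_fun do rewrite ImM_real ImB.
apply: le_trans (normc_ReIm _) _; rewrite !ReB !ImB sE tE -ReB -ImB.
have := le_trans (normc_Re _) (F'c s s01).
have := le_trans (normc_Im _) (F'c t t01).
by lra.
Qed.

End mean_value.

Section compact_bound.
Context {R : realType}.
Import Normc.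

Lemma within_normc (T : topologicalType) (A : set T) (f : T -> R[i]) :
  {within A, continuous f} -> {within A, continuous (fun x => normc (f x) : R)}.
Proof.
move=> fc x; apply/cvgrPdist_lt => e e0.
have /cvg_complexP/(_ e e0) := fc x.
apply: filterS => y /=; apply: le_lt_trans.
rewrite normcB; exact: normc_dist.
Qed.

Lemma compact_normc_bounded (T : topologicalType) (A : set T) (f : T -> R[i]) :
  compact A -> {within A, continuous f} ->
  exists M : R, forall x, A x -> normc (f x) <= M.
Proof.
move=> cA fc; have [A0|A0] := pselect (A !=set0); last first.
  by exists 0 => x Ax; case: A0; exists x.
have [c _ cM] := compact_EVT_max A0 cA (within_normc fc).
by exists (normc (f c)) => x /mem_set; exact: cM.
Qed.

End compact_bound.

Section cube.
Context {R : realType} (d : nat) (a b : R).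

Definition tuple_cube n : set (n.-tuple R) := [set t | cube a b (tnth t)].

Lemma measurable_coordinate n (k : 'I_n) (A : set R) : measurable A ->
  measurable [set t : n.-tuple R | A (tnth t k)].
Proof.
by move=> mA; rewrite -[X in measurable X]setTI; exact: measurable_tnth.
Qed.

Lemma measurable_coordinates n (A : 'I_n -> set R) :
  (forall k, measurable (A k)) ->
  measurable [set t : n.-tuple R | forall k, A k (tnth t k)].
Proof.
move=> mA; rewrite (_ : [set _ | _] =
    \bigcap_(k in [set: 'I_n]) [set t : n.-tuple R | A k (tnth t k)]); last first.
  by apply/seteqP; split=> t /= h k; [move=> _; exact: h|exact: h].
by apply: fin_bigcap_measurable => // k _; exact: measurable_coordinate.
Qed.

Lemma measurable_tuple_cube n : measurable (@tuple_cube n).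
Proof. by apply: measurable_coordinates => k; exact: measurable_itv. Qed.

Lemma lebesgue_tuple_cube n : (lebesgue_tuple R n (@tuple_cube n) < +oo)%E.
Proof.
elim: n => [|n IH]; first by rewrite /= diracE; case: (_ \in _); rewrite ltry.
rewrite /= /lebesgue_cons /pushforward.
rewrite (_ : _ @^-1` _ = `[a, b]%classic `*` @tuple_cube n).
  rewrite product_measure1E//; last exact: measurable_tuple_cube.
  have muab : (lebesgue_measure (`[a, b]%classic : set R) < +oo)%E.
    by rewrite lebesgue_measure_itv/=; case: ifP; rewrite ?ltry// -EFinB ltry.
  by rewrite lte_mul_pinfty// ge0_fin_numE.
apply/seteqP; split=> [[x t] /= h|[x t] [/= hx ht] k].
  split=> [|k] /=; first exact: (h ord0).
  by have := h (lift ord0 k); rewrite tnthS.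
by case: (unliftP ord0 k) => [j|] ->; rewrite ?tnthS ?tnth0//; exact: ht.
Qed.

(** The cells are products of intervals [a + i / (n+1), a + (i+1) / (n+1)[ and
    the marked point is their lower corner, which stays in the cube even for
    the last cell, which may stick out of it. *)
Lemma cube_grid n : exists (I : finType) (c : d.-tuple R -> I)
    (pt : I -> d.-tuple R),
  (forall i, measurable (c @^-1` [set i])) /\
  forall t, tuple_cube t -> tuple_cube (pt (c t)) /\
    forall k, n.+1%:R * `|tnth t k - tnth (pt (c t)) k| <= 1.
Proof.
pose N := Num.truncn (n.+1%:R * (b - a)).
pose cell (x : R) : 'I_N.+1 := inord (Num.truncn (n.+1%:R * (x - a))).
have n0 : 0 < n.+1%:R :> R by rewrite ltr0n.
have mU m : measurable [set x : R | (Num.truncn (n.+1%:R * (x - a)) <= m)%N].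
  rewrite (_ : [set _ | _] = `]-oo, a + m.+1%:R / n.+1%:R[%classic).
    exact: measurable_itv.
  apply/seteqP; split=> x /=; rewrite in_itv/= truncn_le_nat -ltrBlDl
      ltr_pdivlMr// mulrC; exact.
have mE m : measurable [set x : R | Num.truncn (n.+1%:R * (x - a)) = m].
  case: m => [|m].
    rewrite (_ : [set _ | _] = [set x | (Num.truncn (n.+1%:R * (x - a)) <= 0)%N]).
      exact: mU.
    by apply/seteqP; split=> x /=; [move=> ->|rewrite leqn0 => /eqP].
  rewrite (_ : [set _ | _] = [set x | (Num.truncn (n.+1%:R * (x - a)) <= m.+1)%N]
      `\` [set x | (Num.truncn (n.+1%:R * (x - a)) <= m)%N]).
    by apply: measurableD; exact: mU.
  apply/seteqP; split=> x /= => [->|[h1 /negP]]; first by rewrite ltnn.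
  by rewrite -ltnNge => h2; apply/eqP; rewrite eqn_leq h1.
have mcell j : measurable (cell @^-1` [set j]).
  rewrite (_ : _ @^-1` _ = \bigcup_(m in [set m | inord m = j])
      [set x : R | Num.truncn (n.+1%:R * (x - a)) = m]).
    by apply: bigcup_measurable => m _.
  apply/seteqP; split=> x /=; first by move=> h; eexists; [exact: h|].
  by move=> [m <- /= <-].
pose c (t : d.-tuple R) := [ffun k => cell (tnth t k)].
pose pt (i : {ffun 'I_d -> 'I_N.+1}) : d.-tuple R :=
  [tuple a + (i k)%:R / n.+1%:R | k < d].
exists {ffun 'I_d -> 'I_N.+1}, c, pt; split=> [i|t Qt].
  rewrite (_ : _ @^-1` _ = [set t | forall k, (cell @^-1` [set i k]) (tnth t k)]).
    exact: (measurable_coordinates (fun k => mcell (i k))).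
  apply/seteqP; split=> t /=; first by move=> <- k; rewrite ffunE.
  by move=> h; apply/ffunP => k; rewrite ffunE; exact: h.
have key k : [/\ 0 <= tnth t k - a, tnth t k <= b &
    tnth (pt (c t)) k = a + (Num.truncn (n.+1%:R * (tnth t k - a)))%:R / n.+1%:R].
  have := Qt k; rewrite /= in_itv/= => /andP[h1 h2]; split=> //.
    by rewrite subr_ge0.
  rewrite tnth_mktuple ffunE inordK// ltnS le_truncn//.
  by rewrite ler_wpM2l ?(ltW n0)// lerD2r.
split=> k; have [h1 h2 ->] := key k; set x := tnth t k in h1 h2 *.
  have := truncn_le (n.+1%:R * (x - a)); rewrite mulr_ge0 ?(ltW n0)//.
  rewrite mulrC -ler_pdivrMr// => h3; rewrite /= in_itv/=.
  rewrite lerDl divr_ge0//= (le_trans _ h2)// -lerBrDl; exact: h3.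
have := truncn_itv (mulr_ge0 (ltW n0) h1) => /andP[h3 h4].
rewrite opprD addrA -[X in X * _]ger0_norm ?(ltW n0)// -normrM mulrBr.
rewrite [_ * (_ / _)]mulrC divfK ?gt_eqF// ger0_norm ?subr_ge0//.
by rewrite lerBlDr nat1r ltW.
Qed.

End cube.

(** * Lipschitz estimates from partial derivatives *)

Section punctured_limits.
Context {R : realType}.
Import Normc.

Lemma cvg_dnbhs (T : Type) (U : topologicalType) (F : set_system T) (f : T -> U)
    (x : U) : Filter F ->
  f @ F --> x -> (\forall t \near F, f t != x) -> f @ F --> x^'.
Proof.
move=> FF fx fnx A xA; have : F (f @^-1` [set y | y != x -> A y]) by exact: fx.
by apply: filterS2 fnx => t /= ? ; exact.
Qed.

Lemma near_dnbhs0 (T : topologicalType) (x : T) : \forall y \near x^', y != x.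
Proof. by rewrite near_withinE; apply: filterE. Qed.

Lemma cvg_scale_dnbhs (D : R) : D != 0 -> (fun h : R => h * D) @ 0^' --> 0^'.
Proof.
move=> D0; apply: cvg_dnbhs.
  apply: cvg_trans (_ : (fun h : R => h * D) @ (0 : R) --> 0).
    by apply: cvg_app; exact: cvg_within.
  by rewrite -[X in _ --> X](mul0r D); apply: cvgMl; exact: cvg_id.
by apply: filterS (near_dnbhs0 (0 : R)) => h h0; rewrite mulf_neq0.
Qed.

Lemma cvg_complex_scale_dnbhs (D : R[i]) : D != 0 ->
  (fun h : R => h%:C * D) @ 0^' --> 0^'.
Proof.
move=> D0; apply: cvg_dnbhs.
  apply/cvg_complexP => e e0.
  have nD0 : 0 < normc D.
    by rewrite lt_neqAle normc_ge0 eq_sym andbT; apply: contra D0 => /eqP/eq0_normc->.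
  have eD0 : 0 < e / normc D by rewrite divr_gt0.
  apply: cvg_within; apply: filterS (nbhsx_ballx (0 : R) _ eD0) => h.
  rewrite /ball/= sub0r normrN => hD.
  by rewrite subr0 normcM normcR -ltr_pdivlMr.
apply: filterS (near_dnbhs0 (0 : R)) => h h0; rewrite mulf_neq0//.
by apply: contra h0 => /eqP[->].
Qed.

End punctured_limits.

Section lipschitz.
Context {R : realType} (d : nat) (a b : R).
Import Normc.

Definition vector_cube : set 'rV[R]_d := [set x | cube a b (x 0)].

Lemma compact_vector_cube : compact vector_cube.
Proof.
apply: (@rV_compact R d (fun=> `[a, b]%classic)) => _; exact: segment_compact.
Qed.

(** The two points are joined by changing one coordinate at a time, along
    segments that stay in the cube; the partial derivatives are bounded there by
    compactness.  The scale r, which may be any number making the coordinates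
    of r * (x - y) at most 1, matches the difference quotients in the proof of
    existence of the integral. *)
Lemma C1_partial_lipschitz (X : set 'rV[R]_d) (phi : 'rV[R]_d -> R[i]) :
  vector_cube `<=` X -> C1_partial_on X phi ->
  exists L : R, forall x y (r : R), vector_cube x -> vector_cube y -> 0 <= r ->
    (forall k, r * `|x 0 k - y 0 k| <= 1) -> r * normc (phi x - phi y) <= L.
Proof.
move=> KX phiC1.
have /choice[psi psiP] (k : 'I_d) : exists psi : 'rV[R]_d -> R[i],
    (forall x, X x -> is_rpartial k phi x (psi x)) /\ {within X, continuous psi}.
  by have [psi h1 h2] := phiC1 k; exists psi.
have /choice[M MP] (k : 'I_d) : exists M : R,
    forall x, vector_cube x -> normc (psi k x) <= M.
  apply: compact_normc_bounded; first exact: compact_vector_cube.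
  exact: continuous_subspaceW KX (psiP k).2.
pose C := \sum_k `|M k|.
have MC k x : vector_cube x -> normc (psi k x) <= C.
  move=> /(MP k) h; apply: le_trans h _; apply: le_trans (ler_norm _) _.
  by rewrite /C (bigD1 k)//= lerDl sumr_ge0.
have C0 : 0 <= C by rewrite sumr_ge0.
exists (d%:R * (2 * C)) => x y r Kx Ky r0 rxy.
pose z m : 'rV[R]_d := \row_k (if (k < m)%N then x 0 k else y 0 k).
have zx : z d = x by apply/rowP => k; rewrite mxE ltn_ord.
have zy : z 0%N = y by apply/rowP => k; rewrite mxE.
have step (k : 'I_d) : r * normc (phi (z k.+1) - phi (z k)) <= 2 * C.
  pose D := x 0 k - y 0 k.
  pose p (s : R) := z k + (s * D) *: delta_mx 0 k.
  have Kp s : 0 <= s <= 1 -> vector_cube (p s).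
    move=> /andP[s0 s1] j; rewrite /= in_itv/= !mxE eqxx/=.
    have := Kx j; have := Ky j; rewrite /= !in_itv/= => /andP[ya yb] /andP[xa xb].
    have [->|jk] := eqVneq j k; last first.
      by rewrite mulr0 addr0; case: ifP => _; apply/andP.
    rewrite ltnn mulr1; have := Kx k; have := Ky k; rewrite /= !in_itv/= /D.
    by move=> /andP[? ?] /andP[? ?]; apply/andP; split; nra.
  have p1 : p 1 = z k.+1.
    apply/rowP => j; have [->|jk] := eqVneq j k.
      by rewrite !mxE !eqxx ltnSn ltnn mulr1 mul1r addrC subrK.
    have jk' : (nat_of_ord j == k) = false by apply/negbTE.
    by rewrite !mxE eqxx (negbTE jk) mulr0 addr0 ltnS [in RHS]leq_eqVlt jk'.
  have p0 : p 0 = z k by rewrite /p mul0r scale0r addr0.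
  have h : normc (phi (p 1) - phi (p 0) - 0) <= 2 * (`|D| * C).
    apply: (complex_mean_value (F := fun s => phi (p s))
      (F' := fun s => D%:C * psi k (p s))) => s s01; last first.
      by rewrite subr0 normcM normcR ler_wpM2l// MC//; exact: Kp.
    have [D0|D0] := eqVneq D 0.
      have -> : D%:C * psi k (p s) = 0 by rewrite D0 mul0r.
      apply: cvg_near_cst; apply: filterE => h.
      by rewrite /p D0 !mulr0 subrr mulr0.
    have := (psiP k).1 (p s) (KX _ (Kp s s01)).
    move=> /(cvg_comp _ _ (cvg_scale_dnbhs D0)) /cvg_complexP lim.
    have nD : 0 < `|D| by rewrite normr_gt0.
    apply/cvg_complexP => e e0; apply: filterS (lim _ (divr_gt0 e0 nD)) => h /=.
    have -> : p (s + h) = p s + (h * D) *: delta_mx 0 k.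
      by rewrite /p -addrA -scalerDl mulrDl.
    rewrite ltr_pdivlMr// mulrC -normcR -normcM mulrBr mulrA -rmorphM.
    by have -> : D * (h * D)^-1 = h^-1 by rewrite invfM mulrCA mulfV// mulr1.
  rewrite subr0 p1 p0 in h; apply: le_trans (ler_wpM2l r0 h) _.
  have := ler_wpM2r C0 (rxy k); rewrite -/D; lra.
rewrite -zx -zy; have : (d <= d)%N by [].
elim: {1 3 4}d => [|m IH] md; first by rewrite subrr normc0 mulr0 mul0r.
have := IH (ltnW md); have := step (Ordinal md); rewrite /= => h1 h2.
have -> : phi (z m.+1) - phi (z 0%N) =
  (phi (z m.+1) - phi (z m)) + (phi (z m) - phi (z 0%N)) by ring.
apply: le_trans (ler_wpM2l r0 (normc_triangle _ _)) _.
by rewrite mulrDr -nat1r mulrDl mul1r; exact: lerD.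
Qed.

Lemma weakly_C1_lipschitz (E : tvsType R[i]) (V : set 'rV[R[i]]_d)
    (gamma : 'I_d -> R -> R[i]) (g : 'rV[R[i]]_d -> E) (e' : {scalar E}) :
  weakly_C1 V a b gamma g -> continuous e' ->
  exists L : R, forall s t (r : R), cube a b s -> cube a b t -> 0 <= r ->
    (forall k, r * `|s k - t k| <= 1) ->
    r * normc (e' (g (curve gamma s)) - e' (g (curve gamma t))) <= L.
Proof.
move=> [X [gt [[Xo XK _ gtE _] gC1]]] e'c.
have KX : vector_cube `<=` [set x | box X (x 0)].
  by move=> x Kx k; apply: XK; exact: Kx.
have [L LP] := C1_partial_lipschitz KX (gC1 e' e'c).
have gE s : cube a b s -> curve gamma s = curve gt ((\row_k s k : 'rV[R]_d) 0).
  by move=> Ks; apply/rowP => k; rewrite !mxE gtE//; exact: Ks.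
have Krow s : cube a b s -> vector_cube (\row_k s k).
  by move=> Ks k; rewrite mxE; exact: Ks.
exists L => s t r Ks Kt r0 rst; rewrite !gE//.
by apply: LP => //; [exact: Krow|exact: Krow|move=> k; rewrite !mxE].
Qed.

End lipschitz.

(** * Integrals along a curve *)

Section curve_weight.
Context {R : realType} (d : nat) (a b : R).
Import Normc.

Lemma within_itv_proper (t : R) : a < b -> `[a, b]%classic t ->
  ProperFilter (within `[a, b]%classic t^').
Proof.
rewrite /= in_itv/= => altb /andP[at_ tb]; split; last exact: within_filter.
rewrite /within/= => /nbhs_ballP[e /= e0 eA].
pose s := if t < b then Num.min (t + e / 2) b else Num.max (t - e / 2) a.
have [sab st se] : [/\ a <= s <= b, s != t & `|t - s| < e].
  rewrite /s; case: ltP => [tb'|bt].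
    have [h|h] := leP (t + e / 2) b; split.
    - by apply/andP; split; lra.
    - by rewrite gt_eqF//; lra.
    - by rewrite ltr_norml; apply/andP; split; lra.
    - by apply/andP; split; lra.
    - by rewrite gt_eqF//; lra.
    - by rewrite ltr_norml; apply/andP; split; lra.
  have [h|h] := leP (t - e / 2) a; split.
  - by apply/andP; split; lra.
  - by rewrite lt_eqF//; lra.
  - by rewrite ltr_norml; apply/andP; split; lra.
  - by apply/andP; split; lra.
  - by rewrite lt_eqF//; lra.
  - by rewrite ltr_norml; apply/andP; split; lra.
by have := eA s se st; apply; rewrite in_itv.
Qed.

Lemma is_rderiv_unique phi (t : R) l l' : a < b -> `[a, b]%classic t ->
  is_rderiv `[a, b]%classic phi t l -> is_rderiv `[a, b]%classic phi t l' -> l = l'.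
Proof.
move=> altb tab; have PF := within_itv_proper altb tab.
move=> /cvg_complexP h /cvg_complexP h'.
apply: complex_arbitrarily_close => e e0; have e20 : 0 < e / 2 by rewrite divr_gt0.
have [s [hs hs']] := filter_ex (filterI (h _ e20) (h' _ e20)).
set q := _ * _ in hs hs'.
have -> : l - l' = (q - l') - (q - l) by ring.
by apply: le_trans (normc_triangle _ _) _; rewrite normc_opp; lra.
Qed.

Lemma C1_extension_rderiv (V : set 'rV[R[i]]_d) gamma X gammat (k : 'I_d) :
  a < b -> C1_extension V a b gamma X gammat ->
  exists2 psi : R -> R[i], {within `[a, b]%classic, continuous psi} &
    forall t, `[a, b]%classic t -> rderiv `[a, b]%classic (gamma k) t = psi t.
Proof.
move=> altb [Xo XK gC1 gE _]; have [psi psiP psic] := gC1 k.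
exists psi; first exact: continuous_subspaceW (XK k) psic.
move=> t tab; apply: (is_rderiv_unique altb tab (phi := gamma k)); last first.
  have /cvg_complexP h := psiP t (XK k t tab); apply/cvg_complexP => e e0.
  apply: (@filterS _ t^' _ _ _ _ (h e e0)) => s hs sab.
  by rewrite -!gE//; apply: hs; exact: XK.
apply: (@xgetPex _ 0 (is_rderiv `[a, b]%classic (gamma k) t)); exists (psi t).
have /cvg_complexP h := psiP t (XK k t tab); apply/cvg_complexP => e e0.
apply: (@filterS _ t^' _ _ _ _ (h e e0)) => s hs sab.
by rewrite -!gE//; apply: hs; exact: XK.
Qed.

Lemma continuous_bounded_measurable (psi : R -> R[i]) :
  {within `[a, b]%classic, continuous psi} ->
  bounded_measurable `[a, b]%classic psi.
Proof.
move=> psic; have mab : measurable (`[a, b]%classic : set R) by exact: measurable_itv.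
split; last by apply: compact_normc_bounded => //; exact: segment_compact.
split; apply: subspace_continuous_measurable_fun => // x.
- by apply: cvg_Re; exact: psic.
- by apply: cvg_Im; exact: psic.
Qed.

Lemma eq_bounded_measurable dT (T : measurableType dT) (D : set T)
    (phi psi : T -> R[i]) : (forall t, D t -> phi t = psi t) ->
  bounded_measurable D phi -> bounded_measurable D psi.
Proof.
move=> fg [[fr fi] [M fM]]; split; last by exists M => t Dt; rewrite -fg// fM.
by split; [move: fr|move: fi]; apply: eq_measurable_fun => t /set_mem Dt; rewrite fg.
Qed.

(** For a < b this is the continuity of gamma_k'.  For a = b every number is a
    derivative relative to the single point a, so the chosen one is arbitrary;
    but a function on a point is constant. *)
Lemma rderiv_bounded_measurable (V : set 'rV[R[i]]_d) gamma (k : 'I_d) :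
  C1_curve V a b gamma ->
  bounded_measurable `[a, b]%classic (rderiv `[a, b]%classic (gamma k)).
Proof.
move=> [X [gammat gext]]; have [altb|ba] := ltP a b.
  have [psi psic psiE] := C1_extension_rderiv k altb gext.
  apply: (@eq_bounded_measurable _ _ _ psi) => [t /psiE//|].
  exact: continuous_bounded_measurable.
apply: (@eq_bounded_measurable _ _ _
  (fun=> rderiv `[a, b]%classic (gamma k) a)) => [t|].
  rewrite /= in_itv/= => /andP[? ?]; have -> // : t = a by lra.
exact: bounded_measurable_cst.
Qed.

Definition curve_weight (gamma : 'I_d -> R -> R[i]) (t : d.-tuple R) : R[i] :=
  \prod_k rderiv `[a, b]%classic (gamma k) (tnth t k).

Lemma curve_weight_bounded_measurable (V : set 'rV[R[i]]_d) gamma :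
  C1_curve V a b gamma ->
  bounded_measurable (@tuple_cube R a b d) (curve_weight gamma).
Proof.
move=> gC1; apply: bounded_measurable_prod => k.
have [[mr mi] [M gM]] := rderiv_bounded_measurable k gC1.
have mQ := @measurable_tuple_cube R a b d.
have mk : measurable_fun (@tuple_cube R a b d) (@tnth d R ^~ k).
  exact: measurable_funS (@measurable_tnth _ _ d k).
have sub : (@tnth d R ^~ k) @` (@tuple_cube R a b d) `<=` `[a, b]%classic.
  by move=> _ [t Qt <-]; exact: Qt.
have mab : measurable (`[a, b]%classic : set R) by exact: measurable_itv.
split; last by exists M => t Qt; apply: gM; exact: Qt.
split.
- exact: (measurable_comp mab sub mr mk).
- exact: (measurable_comp mab sub mi mk).
Qed.

End curve_weight.

Section curve_integral_exists.
Context {R : realType} {E : tvsType R[i]} (d : nat) (a b : R).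
Hypothesis ab : a <= b.
Context (V : set 'rV[R[i]]_d) (gamma : 'I_d -> R -> R[i]).
Hypothesis gamma_C1 : C1_curve V a b gamma.
Hypotheses (hE : hausdorff_space E) (lcE : locally_complete E).
Implicit Types (g : 'rV[R[i]]_d -> E).
Import Normc.

Let mw := curve_weight_bounded_measurable gamma_C1.
Let mQ := @measurable_tuple_cube R a b d.
Let muQ := @lebesgue_tuple_cube R a b d.

Definition curve_weak_integral g (x : E) :=
  weak_integral (lebesgue_tuple R d) (@tuple_cube R a b d)
    (curve_weight a b gamma) (fun t => g (curve gamma (tnth t))) x.

(** B collects the values of phi and its rescaled differences over points at
    distance at most 1 / n.+1 in each coordinate.  It is weakly bounded by the
    Lipschitz estimate, which also bounds the values once a base point is
    fixed. *)
Lemma curve_weak_integral_exists g : weakly_C1 V a b gamma g ->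
  exists x, curve_weak_integral g x.
Proof.
move=> gC1; pose phi (t : d.-tuple R) := g (curve gamma (tnth t)).
pose close n (s t : d.-tuple R) :=
  forall k, n.+1%:R * `|tnth s k - tnth t k| <= 1 :> R.
pose B : set E := [set y | (exists2 t, tuple_cube a b t & y = phi t) \/
  exists s t n, [/\ tuple_cube a b s, tuple_cube a b t, close n s t &
    y = n.+1%:R *: (phi s - phi t)]].
apply: (weak_integral_exists mQ muQ mw lcE (B := B)).
- move=> e' e'c; have [L LP] := weakly_C1_lipschitz gC1 e'c.
  pose t0 : 'I_d -> R := fun=> a.
  have Kt0 : cube a b t0 by move=> k; rewrite /= in_itv/= lexx.
  (* At this scale every point of the cube is within reach of t0. *)
  pose r := (b - a + 1)^-1.
  have r0 : 0 < r by rewrite invr_gt0 ltr_wpDl// subr_ge0.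
  exists (`|L| + (`|L| / r + normc (e' (g (curve gamma t0))))) => y By.
  have L0 : L <= `|L| := ler_norm L.
  have Lr : 0 <= `|L| / r by rewrite divr_ge0// ltW.
  have n0 := normc_ge0 (e' (g (curve gamma t0))); have nL := normr_ge0 L.
  case: By => [[t Qt ->]|[s [t [n [Qs Qt st ->]]]]].
    rewrite -(subrK (e' (g (curve gamma t0))) (e' (phi t))).
    apply: le_trans (normc_triangle _ _) _; rewrite addrA lerD2r.
    apply: le_trans (_ : `|L| / r <= _); last by rewrite lerDr.
    rewrite ler_pdivlMr// mulrC; apply: le_trans L0; apply: LP => //.
      exact: ltW.
    move=> k; have := Qt k; rewrite /= in_itv/= => /andP[h1 h2].
    rewrite /t0 ger0_norm ?subr_ge0// mulrC ler_pdivrMr; lra.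
  rewrite linearZ/= normcM -(rmorph_nat (real_complex R)) normcR ger0_norm//.
  rewrite linearB; apply: le_trans (LP _ _ _ Qs Qt _ st) _ => //.
  by lra.
- by move=> t Qt; left; exists t.
- move=> n; have [I [c [pt [mc cpt]]]] := @cube_grid R d a b n.
  exists I, c, pt; split=> // t Qt; have [Qp tp] := cpt t Qt; split=> //.
  by right; exists t, (pt (c t)), n.
Qed.

Lemma curve_weak_integralP g x :
  curve_weak_integral g x -> is_curve_integral a b gamma g x.
Proof.
move=> gx Q e' e'c /=; have [mg xE] := gx e' e'c; split; last exact: xE.
apply: bounded_measurable_integrable => //.
exact: bounded_measurableM.
Qed.

Lemma is_curve_integral_unique g x y :
  is_curve_integral a b gamma g x -> is_curve_integral a b gamma g y -> x = y.
Proof.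
move=> gx gy; apply: scalar_separates => // e' e'c.
by rewrite (gx e' e'c).2 (gy e' e'c).2.
Qed.

Lemma weakly_C1_curve_integrable g : weakly_C1 V a b gamma g ->
  curve_integrable a b gamma g /\
  curve_weak_integral g (curve_integral a b gamma g).
Proof.
move=> /curve_weak_integral_exists[x gx]; have ix := curve_weak_integralP gx.
split; first by exists x; split=> // y; exact: is_curve_integral_unique ix.
suff -> : curve_integral a b gamma g = x by [].
exact: (is_curve_integral_unique (xgetPex 0 (ex_intro _ x ix)) ix).
Qed.

(** C is twice the volume of the cube times a bound of the weight; it depends
    neither on g nor on p. *)
Lemma curve_integral_seminorm : exists C : R, 0 <= C /\
  forall g x p (e : R), curve_weak_integral g x -> seminorm p -> continuous p ->
    (forall t, cube a b t -> p (g (curve gamma t)) <= e) -> p x <= C * e.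
Proof.
have [_ [M wM]] := mw; pose m := fine (lebesgue_tuple R d (@tuple_cube R a b d)).
exists (2 * `|M| * m); split; first by rewrite !mulr_ge0// fine_ge0.
move=> g x p e gx ps pc pe.
have := weak_integral_seminorm mQ muQ mw (e := e) (C := `|M|) gx ps pc.
rewrite (_ : _ * e = 2 * (e * `|M|) * m); last by ring.
apply=> t Qt; first by apply: pe; exact: Qt.
by apply: le_trans (wM t Qt) _; exact: ler_norm.
Qed.

End curve_integral_exists.

(** * Dependence on a parameter *)

Section parameter.
Context {R : realType} {E : tvsType R[i]}.
Import Normc.

(** The tube lemma: around (u x, l) the function oscillates by less than e on a
    product neighborhood, and finitely many of these cover K. *)
Lemma near_compact_parameter (S Z L : topologicalType) (K : set S) (u : S -> Z)
    (V : set Z) (U : set L) (F : Z * L -> E) (l : L) p (e : R) :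
  compact K -> (forall x, K x -> u @ x --> u x) -> (forall x, K x -> V (u x)) ->
  open V -> open U -> U l -> {within V `*` U, continuous F} ->
  seminorm p -> continuous p -> 0 < e ->
  \forall m \near l, forall x, K x -> p (F (u x, m) - F (u x, l)) < e.
Proof.
move=> /compact_near_coveringP cK uc uV oV oU Ul /subspace_continuousP Fc ps pc e0.
have e20 : 0 < e / 2 by rewrite divr_gt0.
apply: (cK _ (nbhs l) (fun m x => p (F (u x, m) - F (u x, l)) < e)) => x Kx.
have := cvg_seminormP _ ps pc e20 (Fc (u x, l) (conj (uV x Kx) Ul)).
move=> [[A B] /= [Ax Bl] AB].
have VA : nbhs (u x) (V `&` A).
  by apply: filterI => //; apply: open_nbhs_nbhs; split=> //; exact: uV.
have UB : nbhs l (U `&` B) by apply: filterI => //; exact: open_nbhs_nbhs.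
exists (u @^-1` (V `&` A), U `&` B); first by split=> //; exact: uc.
move=> [y m] /= [[Vy Ay] [Um Bm]].
have hm : p (F (u y, m) - F (u x, l)) < e / 2 by exact: (AB (u y, m)).
have hl : p (F (u y, l) - F (u x, l)) < e / 2.
  by apply: (AB (u y, l)) => //; split=> //; exact: nbhs_singleton.
have -> : F (u y, m) - F (u y, l) = (F (u y, m) - F (u x, l)) +
    - (F (u y, l) - F (u x, l)) by rewrite opprB addrA subrK.
by apply: le_lt_trans (ps.1 _ _) _; rewrite seminormN//; lra.
Qed.

Lemma cvg_row (T : Type) (Q : set_system T) {QF : Filter Q} d
    (f : T -> 'rV[R[i]]_d) (z : 'rV[R[i]]_d) :
  (forall k, (fun t => f t 0 k) @ Q --> z 0 k) -> f @ Q --> z.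
Proof.
move=> fz A [P Pz PA].
have : \forall t \near Q, forall k, P 0 k (f t 0 k).
  by apply: filter_forall => k; exact: (fz k _ (Pz 0 k)).
by apply: filterS => t Pt; apply: PA => i k; rewrite (ord1 i).
Qed.

Lemma near_segment d (j : 'I_d) (l : 'rV[R[i]]_d) (A : set 'rV[R[i]]_d) :
  nbhs l A -> \forall h \near (0 : R[i])^', forall s : R, 0 <= s <= 1 ->
    A (l + (s%:C * h) *: delta_mx 0 j).
Proof.
move=> lA; have : (fun h : R[i] => l + h *: delta_mx 0 j) @ (0 : R[i]) --> l.
  apply: (cvg_row (Q := nbhs (0 : R[i]))) => k; apply/cvg_complexP => e e0.
  apply/nbhs_complexP; exists e => // h; rewrite subr0 => he.
  rewrite !mxE addrAC subrr add0r normcM eqxx /=.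
  by case: eqP => _; rewrite ?normc1 ?normc0 ?mulr1 ?mulr0.
move=> /(_ _ lA) /nbhs_complexP[e e0 eA].
apply: cvg_within; apply/nbhs_complexP; exists e => // h; rewrite subr0 => he s.
move=> /andP[s0 s1]; apply: eA; rewrite subr0 normcM normcR ger0_norm//.
by apply: le_lt_trans he; rewrite ler_piMl// normc_ge0.
Qed.

Lemma is_cpartial_unique d (j : 'I_d) (G : 'rV[R[i]]_d -> E) z l l' :
  hausdorff_space E -> is_cpartial j G z l -> is_cpartial j G z l' -> l = l'.
Proof.
move=> hE; have PF : ProperFilter (0 : R[i])^'.
  split; last exact: dnbhs_filter.
  move=> h0; have := @cvg_complex_scale_dnbhs R 1 (oner_neq0 _) _ h0.
  by move=> /filter_ex[].
exact: cvg_unique.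
Qed.

(** After choosing a functional that attains p at the vector to be estimated,
    this is the mean value inequality for e' o g along the segment, whose
    derivative in s is h * e' (Dg). *)
Lemma cpartial_mean_value d (j : 'I_d) (g Dg : 'rV[R[i]]_d -> E) l (h : R[i]) p
    (e : R) : h != 0 -> seminorm p -> continuous p ->
  (forall s : R, 0 <= s <= 1 -> is_cpartial j g
    (l + (s%:C * h) *: delta_mx 0 j) (Dg (l + (s%:C * h) *: delta_mx 0 j))) ->
  (forall s : R, 0 <= s <= 1 ->
    p (Dg (l + (s%:C * h) *: delta_mx 0 j) - Dg l) <= e) ->
  p (h^-1 *: (g (l + h *: delta_mx 0 j) - g l) - Dg l) <= 2 * e.
Proof.
move=> h0 ps pc gD De; set v := _ - Dg l.
have [e' [e'p <-]] := seminorm_attained v ps.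
apply: le_trans (ler_norm _) _; apply: le_trans (normc_Re _) _.
have nh : 0 < normc h.
  by rewrite lt_neqAle normc_ge0 eq_sym andbT; apply: contra h0 => /eqP/eq0_normc->.
pose q (s : R) := l + (s%:C * h) *: delta_mx 0 j.
have q1 : q 1 = l + h *: delta_mx 0 j by rewrite /q rmorph1 mul1r.
have q0 : q 0 = l by rewrite /q rmorph0 mul0r scale0r addr0.
have key : normc (e' (g (q 1)) - e' (g (q 0)) - h * e' (Dg l)) <=
    2 * (normc h * e).
  apply: (complex_mean_value (F := fun s => e' (g (q s)))
    (F' := fun s => h * e' (Dg (q s)))) => s s01; last first.
    rewrite -mulrBr -linearB normcM ler_pM2l//.
    exact: le_trans (e'p _) (De s s01).
  have := gD s s01; rewrite /is_cpartial -/(q s).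
  move=> /(cvg_comp _ _ (cvg_complex_scale_dnbhs h0)) lim.
  apply/cvg_complexP => r r0.
  apply: filterS (cvg_seminormP _ ps pc (divr_gt0 r0 nh) lim) => t /= ht.
  have -> : q (s + t) = q s + (t%:C * h) *: delta_mx 0 j.
    by rewrite /q -addrA -scalerDl rmorphD mulrDl.
  have tE : (t^-1)%:C = h * (t%:C * h)^-1.
    by rewrite invfM mulrCA mulfV// mulr1 fmorphV.
  rewrite tE -mulrA -mulrBr normcM mulrC -ltr_pdivlMr//.
  by apply: le_lt_trans ht; rewrite -linearB -linearZ -linearB; exact: e'p.
have -> : e' v = h^-1 * (e' (g (q 1)) - e' (g (q 0)) - h * e' (Dg l)).
  by rewrite /v q1 q0 linearB linearZ/= linearB [in RHS]mulrBr mulKf.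
rewrite normcM normcV mulrC ler_pdivrMr//; apply: le_trans key _.
by rewrite mulrA mulrAC.
Qed.

End parameter.

Section curve_continuity.
Context {R : realType}.
Import Normc.

Lemma C1_on_continuous (X : set R) (phi : R -> R[i]) (t : R) :
  open X -> C1_on X phi -> X t -> phi @ t --> phi t.
Proof.
move=> oX [psi psiP _] Xt; apply/cvg_complexP => e e0.
have /cvg_complexP/(_ 1 ltr01) := psiP t Xt.
rewrite !near_withinE => qt.
have Xn : \forall s \near t, X s by exact: open_nbhs_nbhs.
pose c := normc (psi t) + 1.
have c0 : 0 < c by rewrite ltr_wpDl ?normc_ge0.
have tn := nbhsx_ballx t _ (divr_gt0 e0 c0).
apply: filterS (filterI (filterI qt Xn) tn) => s [[qs Xs]].
rewrite /ball/= distrC => st.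
have [->|ns] := eqVneq s t; first by rewrite subrr normc0.
have := qs ns Xs; set w := _ * _ => hw.
have st0 : s - t != 0 by rewrite subr_eq0.
have -> : phi s - phi t = (s - t)%:C * w.
  by rewrite /w mulrA -rmorphM mulfV// rmorph1 mul1r.
have wc : normc w < c.
  rewrite -(subrK (psi t) w); apply: le_lt_trans (normc_triangle _ _) _.
  by rewrite /c addrC ltrD2l.
rewrite normcM normcR; apply: le_lt_trans (ler_wpM2l (normr_ge0 _) (ltW wc)) _.
by rewrite -ltr_pdivlMr.
Qed.

Lemma curve_continuous d (X : 'I_d -> set R) (g : 'I_d -> R -> R[i])
    (x : 'rV[R]_d) : (forall k, open (X k)) -> (forall k, C1_on (X k) (g k)) ->
  box X (x 0) ->
  (fun y : 'rV[R]_d => curve g (y 0)) @ x --> curve g (x 0).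
Proof.
move=> oX gC1 Xx; apply: (cvg_row (Q := nbhs x)) => k.
under eq_fun do rewrite mxE; rewrite mxE.
apply: (cvg_comp (fun y : 'rV[R]_d => y 0 k) (g k) (F := nbhs x) (G := nbhs (x 0 k))).
  move=> A xA; exists (fun _ k' => if k' == k then A else setT) => [i k'|y].
    by rewrite (ord1 i); case: eqP => [->//|_]; exact: filterT.
  by move=> /(_ 0 k); rewrite eqxx.
exact: C1_on_continuous (gC1 k) (Xx k).
Qed.

End curve_continuity.

(** * Interchanging limits and derivatives with the curve integral *)

Theorem lemma4p8 (R : realType) (E : tvsType R[i])
    (E_nontrivial : exists x : E, x != 0)
    (E_hausdorff : hausdorff_space E)
    (E_locally_complete : locally_complete E)
    (d : nat) (d_gt0 : (0 < d)%N)
    (V U : set 'rV[R[i]]_d) (V_open : open V) (U_open : open U)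
    (a b : R) (a_le_b : a <= b)
    (gamma : 'I_d -> R -> R[i]) (gamma_C1 : C1_curve V a b gamma) :
  (forall (T : Type) (f : 'rV[R[i]]_d -> T -> E)
      (f_ : nat -> 'rV[R[i]]_d -> T -> E),
    (forall t, weakly_C1 V a b gamma (f^~ t)) ->
    (forall n t, weakly_C1 V a b gamma (f_ n ^~ t)) ->
    unif_cvg_seminorms (curve gamma @` cube a b `*` [set: T])
      (fun n zt => f_ n zt.1 zt.2) (fun zt => f zt.1 zt.2) ->
    [/\ forall t, curve_integrable a b gamma (f^~ t),
        forall n t, curve_integrable a b gamma (f_ n ^~ t)
      & unif_cvg_seminorms [set: T]
          (fun n t => curve_integral a b gamma (f_ n ^~ t))
          (fun t => curve_integral a b gamma (f^~ t))])
  /\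
  (forall (Ehat : tvsType R[i]) (iota : {linear E -> Ehat}),
    is_completion iota ->
    forall (j : 'I_d) (f : 'rV[R[i]]_d -> 'rV[R[i]]_d -> E),
    (forall lambda, U lambda -> weakly_C1 V a b gamma (f^~ lambda)) ->
    (forall z, V z -> holomorphic iota U (f z)) ->
    (forall z lambda, V z -> U lambda -> exists l, is_cpartial j (f z) lambda l) ->
    {within V `*` U, continuous (fun zl => cpartial j (f zl.1) zl.2)} ->
    (forall lambda, U lambda ->
      weakly_C1 V a b gamma (fun z => cpartial j (f z) lambda)) ->
    let G lambda := curve_integral a b gamma (f^~ lambda) in
    [/\ forall lambda, U lambda -> curve_integrable a b gamma (f^~ lambda),
        forall lambda, U lambda ->
          curve_integrable a b gamma (fun z => cpartial j (f z) lambda),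
        forall lambda, U lambda -> exists l, is_cpartial j G lambda l
      & forall lambda, U lambda ->
          cpartial j G lambda =
          curve_integral a b gamma (fun z => cpartial j (f z) lambda)]).
Proof.
have weakly_C1P := @weakly_C1_curve_integrable R E d a b a_le_b V gamma gamma_C1
  E_hausdorff E_locally_complete.
have mw := curve_weight_bounded_measurable gamma_C1.
have mQ := @measurable_tuple_cube R a b d.
have muQ := @lebesgue_tuple_cube R a b d.
have [C [C0 CP]] := @curve_integral_seminorm R E d a b V gamma gamma_C1.
have C1 : 0 < C + 1 by rewrite ltr_wpDl.
have small (e : R) : 0 < e -> C * (e / (C + 1)) < e.
  by move=> e0; rewrite mulrCA gtr_pMr// ltr_pdivrMr// mul1r ltrDl.
split=> [T f f_ fC1 f_C1 fcvg|Ehat iota _ j f fC1 _ fD Dc DC1 G].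
  split=> [t|n t|p ps pc e e0].
  - exact: (weakly_C1P _ (fC1 t)).1.
  - exact: (weakly_C1P _ (f_C1 n t)).1.
  - have [N NP] := fcvg p ps pc _ (divr_gt0 e0 C1).
    exists N => n Nn t _; apply: le_lt_trans (small e e0).
    have If := (weakly_C1P _ (fC1 t)).2; have Ifn := (weakly_C1P _ (f_C1 n t)).2.
    apply: (CP (fun z => f_ n z t - f z t)) => //.
      exact: (weak_integralB mQ muQ mw Ifn If).
    by move=> s Qs; apply/ltW/(NP n Nn (curve gamma s, t)); split=> //; exists s.
pose D z l := cpartial j (f z) l.
have DP z l : V z -> U l -> is_cpartial j (f z) l (D z l).
  by move=> Vz Ul; have [v fv] := fD z l Vz Ul; exact: (xgetPex 0 (ex_intro _ v fv)).
have [X [gammat [Xo XK gtC1 gtE gtV]]] := gamma_C1.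
have gammaE s : cube a b s ->
    curve gamma s = curve gammat ((\row_k s k : 'rV[R]_d) 0).
  by move=> Ks; apply/rowP => k; rewrite !mxE gtE//; exact: Ks.
have KX (x : 'rV[R]_d) : vector_cube a b x -> box X (x 0).
  by move=> Kx k; apply: XK; exact: Kx.
have KV (x : 'rV[R]_d) : vector_cube a b x -> V (curve gammat (x 0)).
  by move=> /KX Xx; apply: gtV; exists (x 0).
have Krow s : cube a b s -> vector_cube a b (\row_k s k).
  by move=> Ks k; rewrite mxE; exact: Ks.
have GD l : U l -> is_cpartial j G l (curve_integral a b gamma (fun z => D z l)).
  move=> Ul; apply: cvg_seminorm => p ps pc e e0.
  (* The 2 absorbs the factor of the mean value inequality. *)
  pose e1 := e / (C + 1) / 2.
  have e10 : 0 < e1 by rewrite !divr_gt0.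
  have near_l : \forall m \near l, U m /\
      forall x, vector_cube a b x ->
        p (D (curve gammat (x 0)) m - D (curve gammat (x 0)) l) < e1.
    apply: filterI; first exact: open_nbhs_nbhs.
    apply: (near_compact_parameter (F := fun zl => D zl.1 zl.2)
      (u := fun x : 'rV[R]_d => curve gammat (x 0))
      (@compact_vector_cube R d a b) _ KV V_open U_open Ul Dc ps pc e10) => x Kx.
    exact: curve_continuous Xo gtC1 (KX x Kx).
  have near_h := near_segment j near_l.
  apply: filterS (filterI near_h (near_dnbhs0 (0 : R[i]))) => h [hU h0].
  have Ulh : U (l + h *: delta_mx 0 j).
    by have [] := hU 1; rewrite ?ler01 ?lexx// rmorph1 mul1r.
  have Il := (weakly_C1P _ (fC1 l Ul)).2.
  have Ilh := (weakly_C1P _ (fC1 _ Ulh)).2.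
  have ID := (weakly_C1P _ (DC1 l Ul)).2.
  apply: le_lt_trans (small e e0).
  apply: (CP (fun z => h^-1 *: (f z (l + h *: delta_mx 0 j) - f z l) - D z l)) => //.
    apply: (weak_integralB mQ muQ mw _ ID).
    apply: (weak_integralZ mQ muQ mw).
    exact: (weak_integralB mQ muQ mw Ilh Il).
  move=> s Ks; have Vs : V (curve gamma s) by rewrite gammaE//; exact/KV/Krow.
  have -> : e / (C + 1) = 2 * e1 by rewrite /e1; field; rewrite gt_eqF.
  apply: (cpartial_mean_value (g := f (curve gamma s)) (Dg := D (curve gamma s))
    h0 ps pc) => r r01; have [Ur Dr] := hU r r01.
    exact: DP.
  by rewrite gammaE//; apply/ltW/Dr/Krow.
split=> [l Ul|l Ul|l Ul|l Ul].
- exact: (weakly_C1P _ (fC1 l Ul)).1.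
- exact: (weakly_C1P _ (DC1 l Ul)).1.
- by exists (curve_integral a b gamma (fun z => D z l)); exact: GD.
- apply: (is_cpartial_unique E_hausdorff _ (GD l Ul)).
  exact: (xgetPex 0 (ex_intro _ _ (GD l Ul))).
Qed.
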